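(* Let $\omega$ be an admissible subperiod order. The relaxed time-of-use pricing problem, i.e. maximizing $F(G(q,s_0,l))$ over $(q,s_0,l)\in\mathcal Q\times[0,T]\times\mathcal L(\omega)$, is equivalent to maximizing over all $u=(u_q,u_{s},u_l)\in\mathbb{R}^N\times\mathbb{R}\times\mathbb{R}^{\bar m}$ the function $$\widetilde F(u)=F\Big(G\big(\Pi_{\mathcal Q}(\hat u_q),\Pi_{[0,T]}(\hat u_{s}),\Pi_{\mathcal L(\omega)}(\hat u_l)\big)\Big),\qquad\hat u=\Pi_B(u),$$ which is an elementary selection whose selection derivative can be computed in $O(T(\bar S^2+\log T))$ operations (for each client's term of $F$).
   Context: Schedules. $T,N,K\ge1$ are integers, $0\le p^{\mathrm{lb}}<p^{\mathrm{ub}}$, and $(S_n)_{n\le N},(L_n)_{n\le N}$ are integers with $1\le S_n\le L_n$, $\sum_nL_n=T$; $\bar S=\sum_nS_n$. $\mathcal Q=\{q\in\mathbb{R}^N:p^{\mathrm{lb}}\le q_1\le\cdots\le q_N\le p^{\mathrm{ub}}\}$. An admissible subperiod order is a map $\omega:\{1,\dots,\bar m\}\to\{1,\dots,N\}$ with $1\le m_n:=|\omega^{-1}(n)|\le S_n$ for all $n$, $\bar m=\sum_nm_n$, $\omega(1)=1$, and no two cyclically consecutive values equal. $\mathcal L(\omega)=\{(l_s)_{s\le\bar m}:l_s\ge1,\ \sum_{s\in\omega^{-1}(n)}l_s=L_n\ \forall n\}$ (real lengths). With $a_s=s_0+\sum_{r<s}l_r$, $b_s=a_s+l_s$ and $I(s_0,l)(s)=((a_s,b_s]\cup(a_s-T,b_s-T])\cap(0,T]$,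 the price map is $G(q,s_0,l)_t=\sum_{s=1}^{\bar m}q_{\omega(s)}|(t-1,t]\cap I(s_0,l)(s)|$ ($|\cdot|$ Lebesgue measure), $t=1,\dots,T$. $B=[-\Lambda,\Lambda]^{N+1+\bar m}$ is a box with $\Lambda$ large enough that $\mathcal Q\times[0,T]\times\mathcal L(\omega)\subseteq B$. $\Pi$ denotes Euclidean projection. Clients. Each client $k\in\{1,\dots,K\}$ has a weight $w_k\ge 0$, parameters $\alpha_k,\beta_k>0$ and vectors $x_k^0,x_k^{\mathrm{lb}},x_k^{\mathrm{ub}}\in\mathbb{R}^T$ with $0\le x^{\mathrm{lb}}_{t,k}\le x^0_{t,k}\le x^{\mathrm{ub}}_{t,k}$ for all $t$, $\sum_t x^{\mathrm{lb}}_{t,k}<\sum_t x^0_{t,k}<\sum_t x^{\mathrm{ub}}_{t,k}$, and $\sum_{t\in\mathcal T}x^{\mathrm{lb}}_{t,k}+\sum_{t\notin\mathcal T}x^{\mathrm{ub}}_{t,k}\ne\sum_tx^0_{t,k}$ for every $\mathcal T\subseteq\{1,\dots,T\}$. Let $\mathcal X_k=\{x\in\mathbb{R}^T:\sum_t x_t=\sum_t x^0_{t,k},\ x^{\mathrm{lb}}_{k}\le x\le x^{\mathrm{ub}}_{k}\}$, $\mathsf B(p,x)=\sum_tp_tx_t$, $\mathsf V_k(p)=\min_{x\in\mathcal X_k}\{\mathsf B(p,x)+\frac1{2\alpha_k}\|x-x_k^0\|_2^2\}$, $\mathsf V_k^0=\mathsf V_k(p_k^0)$ for a given $p_k^0$,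 $x_k^\star(p)=\Pi_{\mathcal X_k}(x_k^0-\alpha_kp)$, $y_k^\star(p)=\Pi_{[0,1]}(\beta_k(\mathsf V_k^0-\mathsf V_k(p)))$, and $F(p)=\sum_kw_k[\mathsf B(p,x_k^\star(p))-\mathsf C(x_k^\star(p))]y_k^\star(p)$. Elementary selections. A function is elementary (log-exp) if it admits a finite compositional expression involving $+,-,\times,/$, affine maps, $\exp$, $\log$ on its domain. An elementary index is a map $\sigma:\mathbb{R}^d\to\{1,\dots,m\}$ whose level sets are each the solution set of finitely many equalities and inequalities involving elementary functions. A continuous $f:\mathbb{R}^d\to\mathbb{R}$ is an elementary selection if $f(x)=f_{\sigma(x)}(x)$ for all $x$ with $\sigma$ an elementary index and $f_1,\dots,f_m$ elementary; its selection derivative is $x\mapsto\nabla f_{\sigma(x)}(x)$. The cost $\mathsf C:\mathbb{R}^T\to\mathbb{R}$ is an elementary selection with a known selection derivative computable in $O(T)$ operations. Equivalence means that the two problems have the same optimal value and that $u\mapsto(\Pi_{\mathcal Q}(\hat u_q),\Pi_{[0,T]}(\hat u_s),\Pi_{\mathcal L(\omega)}(\hat u_l))$ maps the maximizers of $\widetilde F$ onto the maximizers of the constrained problem.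
   Formalization: The cost C is assumed to have its value, as well as its selection derivative, computable together in O(T) operations (the derivative of the profit needs the value of C); correspondingly the conclusion bounds the joint computation of each client's term and its selection derivative. *)

(* Defs.v *)
From HB Require Import structures.
From mathcomp Require Import all_boot all_order all_algebra.
From mathcomp Require Import all_classical all_reals all_analysis.

Set Implicit Arguments.
Unset Strict Implicit.
Unset Printing Implicit Defensive.

Import Order.TTheory GRing.Theory Num.Theory.
Import numFieldNormedType.Exports.

Local Open Scope classical_set_scope.
Local Open Scope ring_scope.

(* The library norm on row vectors is the sup norm. *)
Definition norm2 (R : realType) d (v : 'rV[R]_d) : R :=
  Num.sqrt (\sum_i v 0 i ^+ 2).

(* The junk value 0 is returned only when no nearest point exists; the nearest
   point is unique for the closed convex sets considered here. *)
Definition proj (R : realType) d (A : set 'rV[R]_d) (u : 'rV[R]_d) : 'rV[R]_d :=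
  xget 0 [set x | A x /\ forall y, A y -> norm2 (u - x) <= norm2 (u - y)].

Definition projR (R : realType) (A : set R) (u : R) : R :=
  xget 0 [set x | A x /\ forall y, A y -> `|u - x| <= `|u - y|].

Definition box (R : realType) d (Lam : R) : set 'rV[R]_d :=
  [set u | forall i, - Lam <= u 0 i <= Lam].

Definition maximizers (R : realType) X (A : set X) (f : X -> R) : set X :=
  [set x | A x /\ forall y, A y -> f y <= f x].

Definition equivalent_unconstrained (R : realType) U Z
    (ft : U -> R) (A : set Z) (f : Z -> R) (h : U -> Z) : Prop :=
  ereal_sup [set (ft u)%:E | u in [set: U]] = ereal_sup [set (f z)%:E | z in A]
  /\ h @` maximizers [set: U] ft = maximizers A f.

(* Affine leaves subsume variables and constants; an affine combination of
   subexpressions is obtained with [EAdd], [EMul] and constant leaves. *)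
Inductive expr (R : realType) (d : nat) : Type :=
| EAff (a : 'rV[R]_d) (b : R)
| EAdd (e1 e2 : expr R d)
| ESub (e1 e2 : expr R d)
| EMul (e1 e2 : expr R d)
| EDiv (e1 e2 : expr R d)
| EExp (e : expr R d)
| ELog (e : expr R d).

Fixpoint eeval (R : realType) d (e : expr R d) (x : 'rV[R]_d) : R :=
  match e with
  | EAff a b => \sum_i a 0 i * x 0 i + b
  | EAdd e1 e2 => eeval e1 x + eeval e2 x
  | ESub e1 e2 => eeval e1 x - eeval e2 x
  | EMul e1 e2 => eeval e1 x * eeval e2 x
  | EDiv e1 e2 => eeval e1 x / eeval e2 x
  | EExp e => expR (eeval e x)
  | ELog e => ln (eeval e x)
  end.

Fixpoint edefined (R : realType) d (e : expr R d) (x : 'rV[R]_d) : Prop :=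
  match e with
  | EAff _ _ => True
  | EAdd e1 e2 | ESub e1 e2 | EMul e1 e2 => edefined e1 x /\ edefined e2 x
  | EDiv e1 e2 => [/\ edefined e1 x, edefined e2 x & eeval e2 x != 0]
  | EExp e => edefined e x
  | ELog e => edefined e x /\ 0 < eeval e x
  end.

(* [f] is a function on the whole of R^d, so its expression must never leave
   the domain of division and of the logarithm. *)
Definition elementary (R : realType) d (f : 'rV[R]_d -> R) : Prop :=
  exists e : expr R d, forall x, edefined e x /\ f x = eeval e x.

Inductive relation := REq | RLe | RLt.

Definition holds (R : realType) (r : relation) (a b : R) : Prop :=
  match r with REq => a = b | RLe => a <= b | RLt => a < b end.

Definition elementary_index (R : realType) d m (sigma : 'rV[R]_d -> 'I_m) :
    Prop :=
  forall i : 'I_m,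
    exists (k : nat) (r : 'I_k -> relation) (g h : 'I_k -> 'rV[R]_d -> R),
      (forall j, elementary (g j) /\ elementary (h j)) /\
      forall x, sigma x = i <-> forall j, holds (r j) (g j x) (h j x).

Definition gradient (R : realType) d (f : 'rV[R]_d -> R) (x : 'rV[R]_d) :
    'rV[R]_d :=
  \row_i 'D_(delta_mx 0 i) f x.

(* [f] is an elementary selection, and [D] is the selection derivative attached
   to one of its representations (it depends on the representation). *)
Definition elementary_selection (R : realType) d
    (f : 'rV[R]_d -> R) (D : 'rV[R]_d -> 'rV[R]_d) : Prop :=
  continuous f /\
  exists (m : nat) (sigma : 'rV[R]_d -> 'I_m) (fs : 'I_m -> 'rV[R]_d -> R),
    [/\ elementary_index sigma,
        forall i, elementary (fs i),
        forall x, f x = fs (sigma x) x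
      & forall x, D x = gradient (fs (sigma x)) x].

(* Algebraic computation trees.  The memory is a list of reals, initially the input; an instruction reads
   cells by address and appends its result. *)
Inductive instr (R : realType) : Type :=
| IConst (c : R)
| IAdd (i j : nat)
| ISub (i j : nat)
| IMul (i j : nat)
| IDiv (i j : nat)
| IExp (i : nat)
| ILog (i : nat).
Arguments IAdd {R}.
Arguments ISub {R}.
Arguments IMul {R}.
Arguments IDiv {R}.
Arguments IExp {R}.
Arguments ILog {R}.

Inductive program (R : realType) : Type :=
| PReturn (out : seq nat)
| PDo (o : instr R) (p : program R)
| PIfLe (i j : nat) (p1 p2 : program R).
Arguments PReturn {R}.

Definition exec (R : realType) (o : instr R) (mem : seq R) : option R :=
  match o with
  | IConst c => Some c
  | IAdd i j => Some (mem`_i + mem`_j)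
  | ISub i j => Some (mem`_i - mem`_j)
  | IMul i j => Some (mem`_i * mem`_j)
  | IDiv i j => if mem`_j != 0 then Some (mem`_i / mem`_j) else None
  | IExp i => Some (expR mem`_i)
  | ILog i => if 0 < mem`_i then Some (ln mem`_i) else None
  end.

Fixpoint run (R : realType) (p : program R) (mem : seq R) : option (seq R) :=
  match p with
  | PReturn out => Some [seq mem`_i | i <- out]
  | PDo o p => if exec o mem is Some v then run p (rcons mem v) else None
  | PIfLe i j p1 p2 => if mem`_i <= mem`_j then run p1 mem else run p2 mem
  end.

(* Worst-case number of executed operations, a comparison counting as one. *)
Fixpoint cost (R : realType) (p : program R) : nat :=
  match p with
  | PReturn _ => 0
  | PDo _ p => (cost p).+1
  | PIfLe _ _ p1 p2 => (maxn (cost p1) (cost p2)).+1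
  end.

Definition coords (R : realType) d (x : 'rV[R]_d) : seq R :=
  [seq x 0 i | i <- enum 'I_d].

(* Computing a selection derivative means evaluating, as automatic
   differentiation does, the function together with its derivative: the chain
   and product rules need the value of the cost as well as its derivative. *)
Definition computes (R : realType) d (P : program R)
    (f : 'rV[R]_d -> R) (D : 'rV[R]_d -> 'rV[R]_d) : Prop :=
  forall x, run P (coords x) = Some (f x :: coords (D x)).

Definition price_levels (R : realType) N (plb pub : R) : set 'rV[R]_N :=
  [set q | (forall n, plb <= q 0 n <= pub) /\
           (forall n n' : 'I_N, (n <= n')%N -> q 0 n <= q 0 n')].

(* The side condition [s != ordS s] only matters for a single subperiod, which
   has no two cyclically consecutive positions. *)
Definition admissible_order N m (S_ : 'I_N -> nat) (omega : 'I_m -> 'I_N) :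
    Prop :=
  [/\ forall n, (1 <= #|[set s | omega s == n]%SET| <= S_ n)%N,
      forall s : 'I_m, s = 0%N :> nat -> omega s = 0%N :> nat
    & forall s : 'I_m, s != ordS s -> omega s != omega (ordS s)].

Definition lengths (R : realType) N m (L_ : 'I_N -> nat)
    (omega : 'I_m -> 'I_N) : set 'rV[R]_m :=
  [set l | (forall s, 1 <= l 0 s) /\
           (forall n, \sum_(s | omega s == n) l 0 s = (L_ n)%:R)].

Definition subperiod_start (R : realType) m (s0 : R) (l : 'rV[R]_m)
    (s : 'I_m) : R :=
  s0 + \sum_(r < m | (r < s)%N) l 0 r.

Definition subperiod (R : realType) (T : nat) m (s0 : R) (l : 'rV[R]_m)
    (s : 'I_m) : set R :=
  let a := subperiod_start s0 l s in
  let b := a + l 0 s in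
  (`]a, b] `|` `]a - T%:R, b - T%:R]) `&` `]0, T%:R].

(* Periods are numbered from 0: [t : 'I_T] is the interval (t, t + 1]. *)
Definition price_map (R : realType) (T N m : nat) (omega : 'I_m -> 'I_N)
    (q : 'rV[R]_N) (s0 : R) (l : 'rV[R]_m) : 'rV[R]_T :=
  \row_(t < T) \sum_(s < m) q 0 (omega s) *
    fine (lebesgue_measure (`]t%:R, t.+1%:R] `&` subperiod T s0 l s)).

Record client (R : realType) (T : nat) : Type := Client {
  cl_w : R;
  cl_alpha : R;
  cl_beta : R;
  cl_x0 : 'rV[R]_T;
  cl_xlb : 'rV[R]_T;
  cl_xub : 'rV[R]_T;
  cl_p0 : 'rV[R]_T }.

Definition admissible_client (R : realType) T (k : client R T) : Prop :=
  [/\ [/\ 0 <= cl_w k, 0 < cl_alpha k & 0 < cl_beta k],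
      forall t, [/\ 0 <= cl_xlb k 0 t, cl_xlb k 0 t <= cl_x0 k 0 t
                  & cl_x0 k 0 t <= cl_xub k 0 t],
      \sum_t cl_xlb k 0 t < \sum_t cl_x0 k 0 t < \sum_t cl_xub k 0 t
    & forall A : {set 'I_T},
        \sum_(t in A) cl_xlb k 0 t + \sum_(t | t \notin A) cl_xub k 0 t
          != \sum_t cl_x0 k 0 t].

Definition loads (R : realType) T (k : client R T) : set 'rV[R]_T :=
  [set x | \sum_t x 0 t = \sum_t cl_x0 k 0 t /\
           forall t, cl_xlb k 0 t <= x 0 t <= cl_xub k 0 t].

Definition bill (R : realType) T (p x : 'rV[R]_T) : R :=
  \sum_t p 0 t * x 0 t.

(* The infimum is attained: [loads k] is compact and contains [cl_x0 k]. *)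
Definition client_value (R : realType) T (k : client R T) (p : 'rV[R]_T) : R :=
  inf [set bill p x + (2 * cl_alpha k)^-1 * norm2 (x - cl_x0 k) ^+ 2
      | x in loads k].

Definition client_load (R : realType) T (k : client R T) (p : 'rV[R]_T) :
    'rV[R]_T :=
  proj (loads k) (cl_x0 k - cl_alpha k *: p).

Definition client_uptake (R : realType) T (k : client R T) (p : 'rV[R]_T) : R :=
  projR `[0, 1]
    (cl_beta k * (client_value k (cl_p0 k) - client_value k p)).

Definition client_profit (R : realType) T (C : 'rV[R]_T -> R) (k : client R T)
    (p : 'rV[R]_T) : R :=
  cl_w k * (bill p (client_load k p) - C (client_load k p)) * client_uptake k p.

Definition profit (R : realType) T K (C : 'rV[R]_T -> R)
    (k : 'I_K -> client R T) (p : 'rV[R]_T) : R :=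
  \sum_i client_profit C (k i) p.

Definition decision (R : realType) N m : Type := ('rV[R]_N * R * 'rV[R]_m)%type.

Definition pack (R : realType) N m (z : decision R N m) : 'rV[R]_(N + 1 + m) :=
  row_mx (row_mx z.1.1 (const_mx z.1.2)) z.2.

Definition unpack (R : realType) N m (u : 'rV[R]_(N + 1 + m)) :
    decision R N m :=
  (lsubmx (lsubmx u), rsubmx (lsubmx u) 0 0, rsubmx u).

Definition feasible (R : realType) (T N m : nat) (plb pub : R)
    (L_ : 'I_N -> nat) (omega : 'I_m -> 'I_N) : set (decision R N m) :=
  [set z | [/\ price_levels plb pub z.1.1, 0 <= z.1.2 <= T%:R
             & lengths L_ omega z.2]].

Definition retract (R : realType) (T N m : nat) (plb pub : R)
    (L_ : 'I_N -> nat) (omega : 'I_m -> 'I_N) (Lam : R)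
    (u : 'rV[R]_(N + 1 + m)) : decision R N m :=
  let z := unpack (proj (box Lam) u) in
  (proj (price_levels plb pub) z.1.1,
   projR `[0, T%:R] z.1.2,
   proj (lengths L_ omega) z.2).

Definition prices (R : realType) (T N m : nat) (omega : 'I_m -> 'I_N)
    (z : decision R N m) : 'rV[R]_T :=
  price_map T omega z.1.1 z.1.2 z.2.

(* Main.v *)
(* [retract] is the identity on feasible decisions and maps onto them, whence the
   equivalence. Each term of the objective is the output of a computation tree
   that only adds, subtracts, multiplies and compares before it evaluates the
   cost C: the projections onto the length and load polytopes are found by
   sorting the breakpoints of the piecewise linear dual function and bisecting
   over them, the projection onto the price levels by pooling adjacent violators
   and clipping, and the prices are sums of differences of clipped subperiod
   end points. At a leaf of the tree the term has the form a - C(z) b with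
   polynomials a, b, z, and the inputs reaching the leaf are cut out by
   polynomial inequalities, so the tree exhibits an elementary selection.
   Differentiating backwards along the executed branch evaluates its derivative
   at five times the cost of the tree. *)
Require Import Defs.
From HB Require Import structures.
From mathcomp Require Import all_boot all_order all_algebra.
From mathcomp Require Import all_classical all_reals all_analysis.
From mathcomp Require Import ring lra zify.

Set Implicit Arguments.
Unset Strict Implicit.
Unset Printing Implicit Defensive.

Import Order.TTheory GRing.Theory Num.Theory.
Import numFieldNormedType.Exports.

Local Open Scope classical_set_scope.
Local Open Scope ring_scope.

(** * Computation trees over cells that are functions of the input *)

(** No program is ever written down: a derivation of [reach] is the tree, carrying at each node its
    memory cells as functions of the input and the set of inputs that get there. The same derivation
    is read in three ways: as a program with a depth bound ([reach_program]), as a partition of the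
    input space by inequalities ([reach_differentiate]), and as an existence proof for the
    projections ([reach_sound]). Outcomes of comparisons, such as a sorted order, active bounds or
    block boundaries, are facts about a node rather than data: rearranging lists costs nothing, and
    reciprocals of counts are constants of the node. This matters because an elementary function
    must be defined on all of R^d, whereas a branch is valid on a part of it only. Before the cost
    is evaluated the tree is therefore restricted to polynomial instructions, which never leave
    their domain. The cost is a black box, kept symbolic at the leaves ([cost_leaf]); its program is
    inlined only during differentiation. Continuity is not read off the tree but proved separately,
    from nonexpansiveness of projections. *)

Section Reach.
Variables (R : realType) (d : nat).
Local Notation fn := ('rV[R]_d -> R).
Implicit Types (es : seq fn) (D : set 'rV[R]_d) (g h : fn) (o : instr R).

(** The default 0 agrees with that of the memory accesses in [exec]: an address past the end reads
    the constant zero. *)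
Definition cell_fun es (i : nat) : fn := nth (fun=> 0) es i.

Definition memory_at (x : 'rV[R]_d) es : seq R := [seq g x | g <- es].

Lemma nth_memory_at x es i : (memory_at x es)`_i = cell_fun es i x.
Proof.
rewrite /memory_at /cell_fun; have [lti|gei] := ltnP i (size es).
  by rewrite (nth_map (fun=> 0)).
by rewrite !nth_default ?size_map.
Qed.

Definition instr_fun o es : fn := fun x =>
  match o with
  | IConst c => c
  | IAdd i j => cell_fun es i x + cell_fun es j x
  | ISub i j => cell_fun es i x - cell_fun es j x
  | IMul i j => cell_fun es i x * cell_fun es j x
  | IDiv i j => cell_fun es i x / cell_fun es j x
  | IExp i => expR (cell_fun es i x)
  | ILog i => ln (cell_fun es i x)
  end.

Definition poly_instr o : bool :=
  match o with IDiv _ _ | IExp _ | ILog _ => false | _ => true end.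

(* A state describes a node of a computation tree: the memory cells as functions
   of the input, and the set of inputs whose execution visits the node. *)
Record state := State { cells : seq fn; dom : set 'rV[R]_d }.

Definition extends (S S' : state) : Prop :=
  (exists es, cells S' = cells S ++ es) /\ dom S' `<=` dom S.

(* [reach full Q n S]: some tree of depth at most [n], rooted at [S], has all
   its leaves in [Q]; division, exp and log are allowed only if [full]. *)
Inductive reach (full : bool) (Q : state -> Prop) : nat -> state -> Prop :=
| reach_done n S : Q S -> reach full Q n S
| reach_do n es D o : full || poly_instr o ->
    (forall x, D x -> exec o (memory_at x es) = Some (instr_fun o es x)) ->
    reach full Q n (State (rcons es (instr_fun o es)) D) ->
    reach full Q n.+1 (State es D)
| reach_if n es D i j :
    reach full Q n (State es (D `&` [set x | cell_fun es i x <= cell_fun es j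
      x])) ->
    reach full Q n (State es (D `&` [set x | cell_fun es j x < cell_fun es i
      x])) ->
    reach full Q n.+1 (State es D).

Lemma extends_refl S : extends S S.
Proof. by split => //; exists [::]; rewrite cats0. Qed.

Lemma extends_trans S1 S2 S3 : extends S1 S2 -> extends S2 S3 -> extends S1 S3.
Proof.
move=> [[e1 E1] D1] [[e2 E2] D2]; split; last by apply: subset_trans D2 D1.
by exists (e1 ++ e2); rewrite E2 E1 catA.
Qed.

Lemma extends_rcons es D g : extends (State es D) (State (rcons es g) D).
Proof. by split => //; exists [:: g]; rewrite cats1. Qed.

Lemma extends_setI es D E : extends (State es D) (State es (D `&` E)).
Proof. by split; [exists [::]; rewrite cats0 | apply: subIsetl]. Qed.

Lemma reach_leq full Q m n S : (m <= n)%N -> reach full Q m S -> reach full Q n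
  S.
Proof.
move=> lemn H; elim: H n lemn => {m S}.
- by move=> n S QS m _; apply: reach_done.
- by move=> n es D o ok ex _ IH [//|m] le; apply: (reach_do ok ex); apply: IH.
- move=> n es D i j _ IH1 _ IH2 [//|m] le.
  by apply: reach_if; [apply: IH1 | apply: IH2].
Qed.

(** Sequencing: the continuation is grafted at every leaf, so depths add. *)
Lemma reach_bind full Q Q' n1 n2 n S :
  reach full Q n1 S ->
  (forall S', extends S S' -> Q S' -> reach full Q' n2 S') ->
  (n1 + n2 <= n)%N ->
  reach full Q' n S.
Proof.
move=> H K le; apply: reach_leq le _ => {n}; elim: H K => {n1 S}.
- move=> n1 S QS K; apply: reach_leq _ (K _ (extends_refl S) QS).
  exact: leq_addl.
- move=> n1 es D o ok ex _ IH K; rewrite addSn; apply: (reach_do ok ex).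
  apply: IH => S' le; apply: K; apply: extends_trans le.
  exact: extends_rcons.
- move=> n1 es D i j _ IH1 _ IH2 K; rewrite addSn;
    apply: (@reach_if _ _ _ _ _ i j).
    by apply: IH1 => S' le; apply: K; apply: extends_trans le;
      apply: extends_setI.
  by apply: IH2 => S' le; apply: K; apply: extends_trans le;
    apply: extends_setI.
Qed.

Lemma reach_weaken full (Q Q' : state -> Prop) n S :
  reach full Q n S -> (forall S', extends S S' -> Q S' -> Q' S') ->
  reach full Q' n S.
Proof.
move=> H K; apply: (reach_bind H (n2 := 0)); last by rewrite addn0.
by move=> S' le QS'; apply: reach_done; apply: K.
Qed.

Lemma reach_sound full Q n S x : reach full Q n S -> dom S x ->
  exists S', [/\ extends S S', Q S' & dom S' x].
Proof.
elim=> {n S}.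
- by move=> n S QS Dx; exists S; split=> //; apply: extends_refl.
- move=> n es D o ok ex _ IH Dx; have [S' [le QS Dx']] := IH Dx.
  by exists S'; split=> //; apply: extends_trans le; apply: extends_rcons.
- move=> n es D i j _ IH1 _ IH2 /= Dx.
  have [le|lt] := leP (cell_fun es i x) (cell_fun es j x).
    have [S' [le' QS Dx']] := IH1 (conj Dx le).
    by exists S'; split=> //; apply: extends_trans le'; apply: extends_setI.
  have [S' [le' QS Dx']] := IH2 (conj Dx lt).
  by exists S'; split=> //; apply: extends_trans le'; apply: extends_setI.
Qed.

(** One address has to serve all inputs of the node; only the value read there depends on [x]. *)
Definition avail (S : state) (g : fn) : Prop :=
  exists i, forall x, dom S x -> cell_fun (cells S) i x = g x.

Lemma cell_fun_extends S S' i : extends S S' -> (i < size (cells S))%N ->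
  cell_fun (cells S') i = cell_fun (cells S) i.
Proof. by move=> [[e ->] _] lti; rewrite /cell_fun nth_cat lti. Qed.

Lemma avail0 S : avail S (fun=> 0).
Proof. by exists (size (cells S)) => x _; rewrite /cell_fun nth_default. Qed.

Lemma avail_extends S S' g : extends S S' -> avail S g -> avail S' g.
Proof.
move=> le [i Hi]; have [lti|gei] := ltnP i (size (cells S)).
  by exists i => x Dx; rewrite (cell_fun_extends le lti) Hi //; apply: le.2.
(* The address pointed past the end and read zero. In [S'] it may be occupied, so a fresh address
   past the end replaces it. *)
have [j Hj] := avail0 S'; exists j => x Dx; rewrite Hj // -Hi; last exact: le.2.
by rewrite /cell_fun nth_default.
Qed.

Lemma avail_eq S g h : avail S g -> (forall x, dom S x -> g x = h x) -> avail S
  h.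
Proof. by move=> [i Hi] e; exists i => x Dx; rewrite Hi // e. Qed.

Lemma avail_rcons es D g : avail (State (rcons es g) D) g.
Proof. by exists (size es) => x _; rewrite /cell_fun /= nth_rcons ltnn eqxx.
  Qed.

Lemma avail_cell S i : avail S (cell_fun (cells S) i).
Proof. by exists i. Qed.

Lemma reach_instr full es D o g :
  full || poly_instr o ->
  (forall x, D x -> exec o (memory_at x es) = Some (instr_fun o es x)) ->
  (forall x, D x -> instr_fun o es x = g x) ->
  reach full (avail^~ g) 1 (State es D).
Proof.
move=> ok ex eg; apply: (reach_do ok ex); apply: reach_done.
exact: avail_eq (avail_rcons _ _ _) eg.
Qed.

Lemma reach_const full S c : reach full (avail^~ (fun=> c)) 1 S.
Proof. by case: S => es D; apply: (@reach_instr _ _ _ (IConst c));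
  rewrite ?orbT. Qed.

Lemma reach_add full S g h : avail S g -> avail S h ->
  reach full (avail^~ (fun x => g x + h x)) 1 S.
Proof.
case: S => es D [i Hi] [j Hj]; apply: (@reach_instr _ _ _ (IAdd i j)).
- by rewrite orbT.
- by move=> x _ /=; rewrite !nth_memory_at.
- by move=> x Dx /=; rewrite Hi // Hj.
Qed.

Lemma reach_sub full S g h : avail S g -> avail S h ->
  reach full (avail^~ (fun x => g x - h x)) 1 S.
Proof.
case: S => es D [i Hi] [j Hj]; apply: (@reach_instr _ _ _ (ISub i j)).
- by rewrite orbT.
- by move=> x _ /=; rewrite !nth_memory_at.
- by move=> x Dx /=; rewrite Hi // Hj.
Qed.

Lemma reach_mul full S g h : avail S g -> avail S h ->
  reach full (avail^~ (fun x => g x * h x)) 1 S.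
Proof.
case: S => es D [i Hi] [j Hj]; apply: (@reach_instr _ _ _ (IMul i j)).
- by rewrite orbT.
- by move=> x _ /=; rewrite !nth_memory_at.
- by move=> x Dx /=; rewrite Hi // Hj.
Qed.

Lemma reach_cmp full S g h : avail S g -> avail S h ->
  reach full (fun S' => (forall x, dom S' x -> g x <= h x) \/
                        (forall x, dom S' x -> h x < g x)) 1 S.
Proof.
case: S => es D [i Hi] [j Hj]; apply: (@reach_if _ _ _ _ _ i j);
  apply: reach_done.
  by left=> x [Dx /=]; rewrite Hi // Hj.
by right=> x [Dx /=]; rewrite Hi // Hj.
Qed.

Definition persistent (Q : state -> Prop) : Prop :=
  forall S S', extends S S' -> Q S -> Q S'.

Lemma persistent_avail g : persistent (avail^~ g).
Proof. by move=> S S'; apply: avail_extends. Qed.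

Lemma reach_each full (I : eqType) (r : seq I) (Q : I -> state -> Prop) c S :
  (forall i, persistent (Q i)) ->
  (forall i S', i \in r -> extends S S' -> reach full (Q i) c S') ->
  reach full (fun S' => forall i, i \in r -> Q i S') (size r * c) S.
Proof.
move=> per; elim: r S => [|i r IH] S H; first by apply: reach_done.
have ri : reach full (Q i) c S by apply: H (extends_refl S); rewrite inE eqxx.
apply: (reach_bind ri (n2 := size r * c)); last by rewrite /= mulSn.
move=> S1 le1 Q1; apply: reach_weaken (IH S1 _) _.
  move=> j S2 jr le2; apply: H; first by rewrite inE jr orbT.
  exact: extends_trans le1 le2.
move=> S2 le2 Q2 j; rewrite inE => /orP[/eqP->|]; last exact: Q2.
exact: per le2 Q1.
Qed.

Lemma reach_forall full (I : finType) (Q : I -> state -> Prop) c S :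
  (forall i, persistent (Q i)) ->
  (forall i S', extends S S' -> reach full (Q i) c S') ->
  reach full (fun S' => forall i, Q i S') (#|I| * c) S.
Proof.
move=> per H; rewrite cardE; apply: reach_weaken (reach_each per _) _.
  by move=> i S' _; apply: H.
by move=> S' _ K i; apply: K; rewrite mem_enum.
Qed.

Lemma reach_sum full (I : eqType) (r : seq I) (g : I -> fn) S :
  (forall i, i \in r -> avail S (g i)) ->
  reach full (avail^~ (fun x => \sum_(i <- r) g i x)) (size r) S.
Proof.
elim: r S => [|i r IH] S av.
  by apply/reach_done/(avail_eq (avail0 S)) => x _; rewrite big_nil.
apply: (reach_bind (IH S _) (n2 := 1)); last by rewrite addn1.
  by move=> j jr; apply: av; rewrite inE jr orbT.
move=> S1 le1 av1; have avi : avail S1 (g i).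
  by apply: avail_extends le1 (av i _); rewrite inE eqxx.
apply: reach_weaken (reach_add full avi av1) _ => S2 _ av2.
by apply: avail_eq av2 _ => x _; rewrite big_cons.
Qed.

Lemma reach_sum_ord full n (g : 'I_n -> fn) S :
  (forall i, avail S (g i)) ->
  reach full (avail^~ (fun x => \sum_i g i x)) n S.
Proof.
move=> av; have := reach_sum full (r := enum 'I_n) (fun i _ => av i).
rewrite size_enum_ord (_ : (fun x => \sum_(i <- enum 'I_n) g i x) = fun x =>
  \sum_i g i x) //.
by apply/funext => x; rewrite big_enum.
Qed.

End Reach.

Arguments avail {R d}.

(** * Elementary functions and their partial derivatives *)

Section Elementary.
Variables (R : realType).

Lemma eeval_differentiable d (e : expr R d) x :
  edefined e x -> differentiable (eeval e) x.
Proof.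
elim: e => [a b _|e1 I1 e2 I2|e1 I1 e2 I2|e1 I1 e2 I2|e1 I1 e2 I2|e I|e I] /=.
- have -> : (fun y : 'rV[R]_d => \sum_i a 0 i * y 0 i + b) =
      (\sum_i (fun y : 'rV[R]_d => a 0 i *: (y 0 i : R))) + cst b.
    by rewrite fct_sumE.
  apply: differentiableD => //; apply: differentiable_sum => i.
  exact/differentiableZ/differentiable_coord.
- by move=> [/I1 d1 /I2 d2]; apply: differentiableD.
- by move=> [/I1 d1 /I2 d2]; apply: differentiableB.
- by move=> [/I1 d1 /I2 d2]; apply: differentiableM.
- move=> [/I1 d1 /I2 d2 n0]; apply: differentiableM => //.
  exact: differentiableV.
- move=> /I d1; apply: (@differentiable_comp _ _ _ _ (eeval e) expR) => //.
  exact/derivable1_diffP/derivable_expR.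
- move=> [/I d1 gt0]; apply: (@differentiable_comp _ _ _ _ (eeval e) (@ln R)) =>
    //.
  by apply/derivable1_diffP; apply: ex_derive; apply: is_derive1_ln.
Qed.

Lemma elementary_differentiable d (f : 'rV[R]_d -> R) x :
  elementary f -> differentiable f x.
Proof.
move=> [e He]; have -> : f = eeval e by apply/funext => y; case: (He y).
by apply: eeval_differentiable; case: (He x).
Qed.

Lemma elementary_derivable d (f : 'rV[R]_d -> R) x v :
  elementary f -> derivable f x v.
Proof. by move=> ef; apply/diff_derivable/elementary_differentiable. Qed.

Lemma elementary_cst d (c : R) : elementary (fun=> c : R) (d := d).
Proof.
exists (EAff 0 c) => x; split => //=.
by rewrite big1 ?add0r // => i _; rewrite mxE mul0r.
Qed.

Lemma elementary_coord d (j : 'I_d) : elementary (fun x : 'rV[R]_d => x 0 j).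
Proof.
exists (EAff (delta_mx 0 j) 0) => x; split => //=.
rewrite (bigD1 j) //= mxE !eqxx mul1r big1 ?addr0 // => i /negPf ij.
by rewrite mxE ij andbF mul0r.
Qed.

Lemma elementaryD d (f g : 'rV[R]_d -> R) :
  elementary f -> elementary g -> elementary (fun x => f x + g x).
Proof.
move=> [e He] [e' He']; exists (EAdd e e') => x /=.
by have [? ->] := He x; have [? ->] := He' x.
Qed.

Lemma elementaryB d (f g : 'rV[R]_d -> R) :
  elementary f -> elementary g -> elementary (fun x => f x - g x).
Proof.
move=> [e He] [e' He']; exists (ESub e e') => x /=.
by have [? ->] := He x; have [? ->] := He' x.
Qed.

Lemma elementaryM d (f g : 'rV[R]_d -> R) :
  elementary f -> elementary g -> elementary (fun x => f x * g x).
Proof.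
move=> [e He] [e' He']; exists (EMul e e') => x /=.
by have [? ->] := He x; have [? ->] := He' x.
Qed.

Lemma elementary_sum d (I : Type) (r : seq I) (f : I -> 'rV[R]_d -> R) :
  (forall i, elementary (f i)) -> elementary (fun x => \sum_(i <- r) f i x).
Proof.
move=> H; elim: r => [|i r IH].
  under eq_fun do rewrite big_nil; exact: elementary_cst.
under eq_fun do rewrite big_cons; exact: elementaryD.
Qed.

Lemma elementary_comp d n (f : 'rV[R]_n -> R) (z : 'I_n -> 'rV[R]_d -> R) :
  elementary f -> (forall t, elementary (z t)) ->
  elementary (fun x => f (\row_t z t x)).
Proof.
move=> [e He] Hz.
suff [e' He'] : exists e', forall x, edefined e (\row_t z t x) ->
    edefined e' x /\ eeval e' x = eeval e (\row_t z t x).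
  exists e' => x; have [def ->] := He (\row_t z t x).
  by have [? ->] := He' _ def.
elim: e {He} => [a b|e1 [g1 I1] e2 [g2 I2]|e1 [g1 I1] e2 [g2 I2]
    |e1 [g1 I1] e2 [g2 I2]|e1 [g1 I1] e2 [g2 I2]|e1 [g1 I1]|e1 [g1 I1]] /=.
- have [e' He'] : elementary (fun x => \sum_i a 0 i * z i x + b).
    apply: elementaryD; last exact: elementary_cst.
    by apply: elementary_sum => i; apply: elementaryM => //;
      apply: elementary_cst.
  exists e' => x _; have [? <-] := He' x; split=> //; congr (_ + _).
  by apply: eq_bigr => i _; rewrite mxE.
- by exists (EAdd g1 g2) => x /= [/I1[? ->] /I2[? ->]].
- by exists (ESub g1 g2) => x /= [/I1[? ->] /I2[? ->]].
- by exists (EMul g1 g2) => x /= [/I1[? ->] /I2[? ->]].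
- by exists (EDiv g1 g2) => x /= [/I1[? ->] /I2[? ->]] ?.
- by exists (EExp g1) => x /= /I1[? ->].
- by exists (ELog g1) => x /= [/I1[? ->]].
Qed.

(** * Partial derivatives of elementary functions *)

Section Partial.
Variables (d : nat) (i : 'I_d).
Implicit Types (f g : 'rV[R]_d -> R).

Definition partial f (x : 'rV[R]_d) : R := 'D_(delta_mx 0 i) f x.

Lemma partial_cst c x : partial (fun=> c) x = 0.
Proof. exact: derive_cst. Qed.

Lemma partial_coord (j : 'I_d) x : partial (fun y => y 0 j) x = (j == i)%:R.
Proof.
rewrite /partial deriveE; last exact: differentiable_coord.
have @f : {linear 'rV[R]_d -> R}.
  by exists (fun N : 'rV[R]_d => N 0 j); do 2![eexists]; do ?[constructor];
     rewrite ?mxE// => ? *; rewrite ?mxE//; move=> ?; rewrite !mxE.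
rewrite (_ : (fun _ => _) = f) // diff_lin; last exact: coord_continuous.
by rewrite /= mxE eqxx.
Qed.

Lemma partialD f g x : elementary f -> elementary g ->
  partial (fun y => f y + g y) x = partial f x + partial g x.
Proof. by move=> ef eg; apply: deriveD; apply: elementary_derivable. Qed.

Lemma partialB f g x : elementary f -> elementary g ->
  partial (fun y => f y - g y) x = partial f x - partial g x.
Proof. by move=> ef eg; apply: deriveB; apply: elementary_derivable. Qed.

Lemma partialM f g x : elementary f -> elementary g ->
  partial (fun y => f y * g y) x = f x * partial g x + g x * partial f x.
Proof. by move=> ef eg; apply: deriveM; apply: elementary_derivable. Qed.

End Partial.

(** Chain rule: the inner map is a sum of scalar functions times basis rows, so its differential
    splits into partial derivatives. *)
Lemma partial_comp d n (f : 'rV[R]_n -> R) (z : 'I_n -> 'rV[R]_d -> R) i x :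
  elementary f -> (forall t, elementary (z t)) ->
  partial i (fun y => f (\row_t z t y)) x =
  \sum_t partial t f (\row_t z t x) * partial i (z t) x.
Proof.
move=> ef ez; pose Z (y : 'rV[R]_d) := \row_t z t y.
have ZE : Z = \sum_t (fun y => z t y *: (delta_mx 0 t : 'rV[R]_n)).
  apply/funext => y; rewrite fct_sumE; apply/rowP => t.
  rewrite !mxE summxE (bigD1 t) //= !mxE !eqxx mulr1 big1 ?addr0 // =>
    s /negPf st.
  by rewrite !mxE eq_sym st andbF mulr0.
have dz t : differentiable (fun y => z t y *: (delta_mx 0 t : 'rV[R]_n)) x.
  apply: (@differentiable_comp _ _ _ _ (z t) (fun k => k *: _)).
    exact: elementary_differentiable.
  have := is_diff_scalel (z t x) (delta_mx 0 t : 'rV[R]_n).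
  by case.
have dZ : differentiable Z x by rewrite ZE; apply: differentiable_sum.
have df : differentiable f (Z x) by apply: elementary_differentiable.
rewrite /partial deriveE; last exact: differentiable_comp dZ df.
rewrite (diff_comp dZ df) /= -(deriveE _ dZ) ZE derive_sum; last first.
  by move=> t; apply: diff_derivable.
rewrite linear_sum; apply: eq_bigr => t _.
rewrite -ZE (deriveE _ df) (deriveE _ (dz t)).
have dzt := elementary_differentiable x (ez t).
rewrite (@diff_comp _ _ _ _ (z t) (fun k =>
  k *: (delta_mx 0 t : 'rV[R]_n))) //=.
have [_ ->] := is_diff_scalel (z t x) (delta_mx 0 t : 'rV[R]_n).
by rewrite linearZ (deriveE _ dzt) mulrC.
Qed.

End Elementary.

(** * Elementary selections *)

Section Selection.
Variables (R : realType) (d : nat).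
Local Notation fn := ('rV[R]_d -> R).

Definition basic_set (X : set 'rV[R]_d) : Prop :=
  exists (J : finType) (r : J -> relation) (g h : J -> fn),
    (forall j, elementary (g j) /\ elementary (h j)) /\
    forall x, X x <-> forall j, holds (r j) (g j x) (h j x).

Lemma basic_set1 r (g h : fn) : elementary g -> elementary h ->
  basic_set [set x | holds r (g x) (h x)].
Proof.
move=> eg eh; exists unit, (fun=> r), (fun=> g), (fun=> h); split=> // x.
by split=> [H [//]|/(_ tt)].
Qed.

Lemma basic_setI X Y : basic_set X -> basic_set Y -> basic_set (X `&` Y).
Proof.
move=> [J [r [g [h [e H]]]]] [J' [r' [g' [h' [e' H']]]]].
pose pick (A : Type) (u : J -> A) (u' : J' -> A) (j : J + J') :=
  match j with inl i => u i | inr i => u' i end.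
exists (J + J')%type, (pick _ r r'), (pick _ g g'), (pick _ h h'); split.
  by case.
move=> x; split=> [[/H Xx /H' Yx] []//|K]; split.
  by apply/H => j; apply: (K (inl j)).
by apply/H' => j; apply: (K (inr j)).
Qed.

(** The version of [elementary_selection] for a node: level sets are prescribed only inside [D], and
    continuity is left out. An arbitrary finite index type allows products and disjoint unions of
    indices. *)
Definition selection_on (D : set 'rV[R]_d) (f : fn)
    (Df : 'rV[R]_d -> 'rV[R]_d) : Prop :=
  exists (I : finType) (sigma : 'rV[R]_d -> I) (fs : I -> fn),
  [/\ forall i, exists X, basic_set X /\ forall x, D x -> (sigma x = i <-> X x),
      forall i, elementary (fs i),
      forall x, D x -> f x = fs (sigma x) x
    & forall x, D x -> Df x = gradient (fs (sigma x)) x].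

Lemma selection_onT (f : fn) Df : continuous f -> selection_on setT f Df ->
  elementary_selection f Df.
Proof.
move=> cf [I [sigma [fs [bas el ef eD]]]]; split=> //.
exists #|I|, (fun x => enum_rank (sigma x)), (fun i => fs (enum_val i));
  split=> //.
- move=> i; have [X [[J [r [g [h [e H]]]]] HX]] := bas (enum_val i).
  exists #|J|, (fun j => r (enum_val j)), (fun j => g (enum_val j)),
    (fun j => h (enum_val j)); split=> // x; split.
    move=> si j; apply: (H x).1; apply/HX => //.
    by rewrite -si enum_rankK.
  move=> K; apply: enum_val_inj; rewrite enum_rankK; apply/HX => //.
  by apply/H => j; have := K (enum_rank j); rewrite enum_rankK.
- by move=> x; rewrite enum_rankK ef.
- by move=> x; rewrite enum_rankK eD.
Qed.

Lemma elementary_selection_on (f : fn) Df : elementary_selection f Df ->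
  selection_on setT f Df.
Proof.
move=> [_ [m [sigma [fs [bas el ef eD]]]]].
exists 'I_m, sigma, fs; split=> // i.
have [k [r [g [h [e H]]]]] := bas i.
exists [set x | forall j, holds (r j) (g j x) (h j x)]; split; last first.
  by move=> x _; apply: H.
by exists 'I_k, r, g, h; split=> // x; apply: iff_refl.
Qed.

Lemma elementary_selection0 : elementary_selection (fun=> 0 : R) (fun=> 0 :
  'rV[R]_d).
Proof.
apply: selection_onT; first exact: cst_continuous.
exists unit, (fun=> tt), (fun _ _ => 0); split=> //.
- move=> []; exists setT; split=> //.
  exists void, (fun=> REq), (fun _ _ => 0), (fun _ _ => 0).
  by split=> [[]|x]; split=> // _ [].
- by move=> _; apply: elementary_cst.
- move=> x _; apply/rowP => i; rewrite !mxE.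
  by rewrite -[RHS]/(partial i (fun=> 0) x) partial_cst.
Qed.

Lemma elementary_selectionD (f g : fn) Df Dg :
  elementary_selection f Df -> elementary_selection g Dg ->
  elementary_selection (fun x => f x + g x) (fun x => Df x + Dg x).
Proof.
move=> sf sg; have [cf _] := sf; have [cg _] := sg.
apply: selection_onT; first by move=> x; apply: (continuousD (cf x) (cg x)).
have [I [s [fs [b el ef eD]]]] := elementary_selection_on sf.
have [I' [s' [fs' [b' el' ef' eD']]]] := elementary_selection_on sg.
exists (I * I')%type, (fun x => (s x, s' x)), (fun i x => fs i.1 x + fs' i.2 x).
split.
- move=> [i i']; have [X [bX HX]] := b i; have [X' [bX' HX']] := b' i'.
  exists (X `&` X'); split; first exact: basic_setI.
  move=> x _; split=> [[ei ei']|[Xx Xx']]; first by split; [apply/HX|apply/HX'].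
  by congr (_, _); [apply/HX|apply/HX'].
- by move=> [i i']; apply: elementaryD.
- by move=> x _; rewrite ef // ef'.
- move=> x _; rewrite eD // eD' //; apply/rowP => i; rewrite !mxE.
  exact/esym/partialD.
Qed.

Lemma elementary_selection_sum (I : Type) (r : seq I) (f : I -> fn)
    (Df : I -> 'rV[R]_d -> 'rV[R]_d) :
  (forall i, elementary_selection (f i) (Df i)) ->
  elementary_selection (fun x => \sum_(i <- r) f i x) (fun x =>
    \sum_(i <- r) Df i x).
Proof.
move=> H; elim: r => [|i r IH].
  under eq_fun do rewrite big_nil; under [X in elementary_selection _ X]eq_fun
    do rewrite big_nil.
  exact: elementary_selection0.
under eq_fun do rewrite big_cons; under [X in elementary_selection _ X]eq_fun do
  rewrite big_cons.
exact: elementary_selectionD.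
Qed.

(** Gluing at a comparison: the index is a disjoint union, and each level set receives the single
    inequality of its branch. Those of the ancestors are still contained in [D] and get added higher
    up. *)
Lemma selection_on_cond (D : set 'rV[R]_d) f D1 D2 (g h : fn) :
  elementary g -> elementary h ->
  selection_on (D `&` [set x | g x <= h x]) f D1 ->
  selection_on (D `&` [set x | h x < g x]) f D2 ->
  selection_on D f (fun x => if g x <= h x then D1 x else D2 x).
Proof.
move=> eg eh [I [s [fs [b el ef eD]]]] [I' [s' [fs' [b' el' ef' eD']]]].
exists (I + I')%type, (fun x => if g x <= h x then inl (s x) else inr (s' x)),
  (fun i => match i with inl i => fs i | inr i => fs' i end); split.
- case=> i.
    have [X [bX HX]] := b i; exists ([set x | g x <= h x] `&` X); split.
      exact: basic_setI (basic_set1 RLe eg eh) bX.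
    move=> x Dx; split.
      by case: leP => // le [si]; split=> //; apply/HX.
    by move=> [/= le Xx]; rewrite le; congr inl; apply/HX.
  have [X [bX HX]] := b' i; exists ([set x | h x < g x] `&` X); split.
    exact: basic_setI (basic_set1 RLt eh eg) bX.
  move=> x Dx; split.
    by case: leP => // lt [si]; split=> //; apply/HX.
  by move=> [/= lt Xx]; rewrite leNgt lt /=; congr inr; apply/HX.
- by case.
- by move=> x Dx; case: leP => [le|lt]; [apply: ef|apply: ef'].
- by move=> x Dx; case: leP => [le|lt]; [apply: eD|apply: eD'].
Qed.

Lemma selection_on_eq (D : set 'rV[R]_d) f f' Df : (forall x, D x -> f x = f' x)
  ->
  selection_on D f Df -> selection_on D f' Df.
Proof.
move=> e [I [s [fs [b el ef eD]]]]; exists I, s, fs; split=> // x Dx.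
by rewrite -e // ef.
Qed.

End Selection.

Lemma basic_set_comp (R : realType) d n (X : set 'rV[R]_n) (z : 'I_n -> 'rV[R]_d
  -> R) :
  basic_set X -> (forall t, elementary (z t)) ->
  basic_set [set x | X (\row_t z t x)].
Proof.
move=> [J [r [g [h [e H]]]]] ez.
exists J, r, (fun j x => g j (\row_t z t x)), (fun j x => h j (\row_t z t x)).
by split=> [j|x]; [split; apply: elementary_comp => //; apply e | apply: H].
Qed.

(** The index of [C] is pulled back along [z]. The derivative is laid out as the reverse sweep
    delivers it: weight 1 on [a], [- C] on [b], and [- b * dC] on the components of [z]. *)
Lemma selection_on_leaf (R : realType) d n (D : set 'rV[R]_d)
    (C : 'rV[R]_n -> R) dC (a b : 'rV[R]_d -> R) (z : 'I_n -> 'rV[R]_d -> R) :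
  elementary_selection C dC -> elementary a -> elementary b ->
  (forall t, elementary (z t)) ->
  selection_on D (fun x => a x - C (\row_t z t x) * b x)
    (fun x => \row_i (partial i a x + - C (\row_t z t x) * partial i b x
       - \sum_t b x * dC (\row_t z t x) 0 t * partial i (z t) x)).
Proof.
move=> /elementary_selection_on [I [s [fs [bas el ef eD]]]] ea eb ez.
exists I, (fun x => s (\row_t z t x)), (fun i x =>
  a x - fs i (\row_t z t x) * b x).
split.
- move=> i; have [X [bX HX]] := bas i.
  exists [set x | X (\row_t z t x)]; split; first exact: basic_set_comp.
  by move=> x _; apply: HX.
- by move=> i; apply/elementaryB => //; apply: elementaryM => //;
    apply: elementary_comp.
- by move=> x _; rewrite -ef.
- move=> x _; apply/rowP => i; rewrite !mxE.
  set j := s _; have ec : elementary (fun y => fs j (\row_t z t y)).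
    exact: elementary_comp.
  rewrite -[RHS]/(partial i _ x) partialB //; last exact: elementaryM.
  rewrite partialM // partial_comp // -/j -ef // opprD addrA mulNr;
    congr (_ - _).
  rewrite mulr_sumr; apply: eq_bigr => t _.
  by rewrite eD // mxE -/j mulrA.
Qed.

(** * Programs and reverse-mode differentiation *)

Section Run.
Variables (R : realType) (d : nat).
Local Notation fn := ('rV[R]_d -> R).
Implicit Types (S : state R d) (g h f : fn).

Definition outputs (outs : 'rV[R]_d -> seq R) S : Prop :=
  exists addr : seq nat, forall x, dom S x ->
    outs x = [seq cell_fun (cells S) i x | i <- addr].

Lemma outputs_avail (I : Type) (r : seq I) (g : I -> fn) S :
  (forall i, avail S (g i)) -> outputs (fun x => [seq g i x | i <- r]) S.
Proof.
move=> /choice [a Ha]; exists [seq a i | i <- r] => x Dx.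
by rewrite -map_comp; apply: eq_map => i /=; rewrite Ha.
Qed.

Lemma outputs_cons g outs S : avail S g -> outputs outs S ->
  outputs (fun x => g x :: outs x) S.
Proof.
by move=> [i Hi] [a Ha]; exists (i :: a) => x Dx /=; rewrite Hi // Ha.
Qed.

Lemma reach_program full outs n S : reach full (outputs outs) n S ->
  exists P : program R, (cost P <= n)%N /\
    forall x, dom S x -> run P (memory_at x (cells S)) = Some (outs x).
Proof.
elim=> {n S} [n S [a Ha]|n es D o _ ex _ [P [cP HP]]
    |n es D i j _ [P [cP HP]] _ [P' [cP' HP']]].
- exists (PReturn a); split=> // x Dx /=; rewrite Ha //.
  by congr Some; apply: eq_map => i; rewrite nth_memory_at.
- exists (PDo o P); split=> // x Dx /=; rewrite ex //.
  by rewrite -HP // /memory_at /= map_rcons.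
- exists (PIfLe i j P P'); split; first by rewrite /= ltnS geq_max cP cP'.
  move=> x Dx /=; rewrite !nth_memory_at; case: leP => [le|lt]; first exact: HP.
  exact: HP'.
Qed.

Definition relocate (a : nat -> nat) (o : instr R) : instr R :=
  match o with
  | IConst c => IConst c
  | IAdd i j => IAdd (a i) (a j)
  | ISub i j => ISub (a i) (a j)
  | IMul i j => IMul (a i) (a j)
  | IDiv i j => IDiv (a i) (a j)
  | IExp i => IExp (a i)
  | ILog i => ILog (a i)
  end.

(** Inlines a finished program: its private memory [zs] may be scattered over the cells of [S], and
    every address is translated through a choice of such cells. *)
Lemma reach_run P (zs : seq fn) outs S :
  (forall i, avail S (cell_fun zs i)) ->
  (forall x, dom S x -> run P (memory_at x zs) = Some (outs x)) ->
  reach true (outputs outs) (cost P) S.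
Proof.
elim: P zs S => [out|o P IH|i j P1 IH1 P2 IH2] zs S av /=.
- move=> H; apply: reach_done.
  have [a Ha] := choice av; exists [seq a i | i <- out] => x Dx.
  have [<-] := H x Dx; rewrite -map_comp; apply: eq_map => i /=.
  by rewrite nth_memory_at Ha.
- case: S av => es D av H; have [a Ha] := choice av.
  have exE x : D x -> exec o (memory_at x zs) = Some (instr_fun o zs x) /\
      exec (relocate a o) (memory_at x es) = Some (instr_fun (relocate a o) es
        x) /\
      instr_fun (relocate a o) es x = instr_fun o zs x.
    move=> Dx; have := H x Dx; have {}Ha i := Ha i x Dx; rewrite /= in Ha.
    by case: (o) => [c|i j|i j|i j|i j|i|i] /=; rewrite ?nth_memory_at ?Ha //;
      case: ifP.
  apply: (reach_do (o := relocate a o)) => //; first by move=> x /exE [_ []].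
  apply: (IH (rcons zs (instr_fun o zs))) => [i|x /= Dx]; last first.
    by have := H x Dx; rewrite (exE x Dx).1 /memory_at map_rcons.
  rewrite /cell_fun nth_rcons; case: ltngtP => [lti|_|_].
  + exact: avail_extends (extends_rcons _ _ _) (av i).
  + exact: avail0.
  + apply: avail_eq (avail_rcons _ _ _) _ => x Dx.
    by rewrite (exE x Dx).2.2.
- case: S av => es D av H; have [i' Hi] := av i; have [j' Hj] := av j.
  apply: (@reach_if _ _ _ _ _ _ _ i' j').
    apply: reach_leq (leq_maxl _ _) _; apply: (IH1 zs).
      by move=> k; apply: avail_extends (extends_setI _ _ _) (av k).
    move=> x /= [Dx]; rewrite Hi // Hj // => le.
    by have := H x Dx; rewrite !nth_memory_at le.
  apply: reach_leq (leq_maxr _ _) _; apply: (IH2 zs).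
    by move=> k; apply: avail_extends (extends_setI _ _ _) (av k).
  move=> x /= [Dx]; rewrite Hi // Hj // => lt.
  by have := H x Dx; rewrite !nth_memory_at leNgt lt.
Qed.

End Run.

(** * Reverse sweep along a tape of polynomial instructions *)

Section Reverse.
Variables (R : realType) (d : nat).
Local Notation fn := ('rV[R]_d -> R).
Implicit Types (es : seq fn) (S : state R d).

Definition input_cells : seq fn := [seq (fun x : 'rV[R]_d =>
  x 0 i) | i <- enum 'I_d].

Lemma size_input_cells : size input_cells = d.
Proof. by rewrite size_map size_enum_ord. Qed.

Lemma cell_fun_input (i : 'I_d) : cell_fun input_cells i = fun x => x 0 i.
Proof. by rewrite /cell_fun (nth_map i) ?size_enum_ord // nth_ord_enum. Qed.

(** Such cells are elementary on the whole space, not only on the inputs reaching the node. *)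
Inductive tape : seq fn -> Prop :=
| tape_input : tape input_cells
| tape_rcons es o : tape es -> poly_instr o -> tape (rcons es (instr_fun o es)).

Lemma tape_elementary es i : tape es -> elementary (cell_fun es i).
Proof.
move=> tp; elim: tp i => {es} [|es o _ IH ok] i.
  have [lti|gei] := ltnP i d; first by rewrite (cell_fun_input (Ordinal lti));
    apply: elementary_coord.
  by rewrite /cell_fun nth_default ?size_input_cells //; apply: elementary_cst.
rewrite /cell_fun nth_rcons; case: ltngtP => _;
  [exact: IH|exact: elementary_cst|].
case: o ok => //= [c|j k|j k|j k] _ /=;
  [exact: elementary_cst|exact: elementaryD
  |exact: elementaryB|exact: elementaryM].
Qed.

Lemma tape_size es : tape es -> (d <= size es)%N.
Proof.
elim=> {es} [|es o _ le _]; first by rewrite size_input_cells.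
by rewrite size_rcons leqW.
Qed.

(* The adjoints of the first [n] cells are in memory; they represent the linear
   functional [L], to be applied to the derivatives of these cells. *)
Definition adjoint n (L : (nat -> R) -> fn) S : Prop :=
  exists adj : nat -> fn, (forall k, avail S (adj k)) /\
    forall x w, (forall k, (n <= k)%N -> w k = 0) ->
      \sum_(k < n) adj k x * w k = L w x.

Lemma adjoint_extends n L S S' : extends S S' -> adjoint n L S -> adjoint n L
  S'.
Proof.
by move=> le [adj [av H]]; exists adj; split=> // k;
  apply: avail_extends le (av k).
Qed.

Lemma adjoint_eq n L L' S :
  (forall x w, (forall k, (n <= k)%N -> w k = 0) -> L w x = L' w x) ->
  adjoint n L S -> adjoint n L' S.
Proof. by move=> e [adj [av H]]; exists adj; split=> // x w Hw;
  rewrite H ?e. Qed.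

Lemma adjoint0 n S : adjoint n (fun _ _ => 0) S.
Proof.
exists (fun=> fun=> 0); split=> [k|x w _]; first exact: avail0.
by rewrite big1 // => k _; rewrite mul0r.
Qed.

(** An address [k] past [n] is harmless: no entry is updated, and [w k] is zero. *)
Lemma sum_update n k (adj : nat -> R) (v : R) w :
  (forall k, (n <= k)%N -> w k = 0) ->
  \sum_(i < n) (if i == k :> nat then v else adj i) * w i =
  \sum_(i < n) adj i * w i + (v - adj k) * w k.
Proof.
move=> Hw; have [ltk|gek] := ltnP k n; last first.
  rewrite Hw // mulr0 addr0; apply: eq_bigr => i _.
  by rewrite ltn_eqF // (leq_trans (ltn_ord i)).
rewrite (bigD1 (Ordinal ltk)) //= eqxx [in RHS](bigD1 (Ordinal ltk)) //=.
rewrite (eq_bigr (fun i : 'I_n => adj i * w i)); last first.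
  by move=> i; rewrite -val_eqE /= => /negPf ->.
by ring.
Qed.

(** Memory is append-only, so accumulating into an adjoint stores the new sum in a fresh cell and
    redirects index [k] to it. *)
Lemma reach_adjointD n k L S (v : fn) : adjoint n L S -> avail S v ->
  reach true (adjoint n (fun w x => L w x + v x * w k)) 1 S.
Proof.
move=> [adj [av H]] avv; apply: reach_weaken (reach_add true (av k) avv) _.
move=> S' le avS'.
exists (fun i => if i == k then (fun x => adj k x + v x) else adj i); split.
  by move=> i; case: eqP => // _; apply: avail_extends le (av i).
move=> x w Hw; rewrite (eq_bigr (fun i : 'I_n =>
  (if i == k :> nat then adj k x + v x else adj i x) * w i)); last first.
  by move=> i _; case: eqP.
by rewrite (@sum_update _ _ (fun i => adj i x)) // H // addrAC subrr add0r.
Qed.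

Lemma reach_adjointB n k L S (v : fn) : adjoint n L S -> avail S v ->
  reach true (adjoint n (fun w x => L w x - v x * w k)) 1 S.
Proof.
move=> [adj [av H]] avv; apply: reach_weaken (reach_sub true (av k) avv) _.
move=> S' le avS'.
exists (fun i => if i == k then (fun x => adj k x - v x) else adj i); split.
  by move=> i; case: eqP => // _; apply: avail_extends le (av i).
move=> x w Hw; rewrite (eq_bigr (fun i : 'I_n =>
  (if i == k :> nat then adj k x - v x else adj i x) * w i)); last first.
  by move=> i _; case: eqP.
by rewrite (@sum_update _ _ (fun i =>
  adj i x)) // H // addrAC subrr add0r mulNr.
Qed.

Definition gradient_avail (L : (nat -> R) -> fn) es S : Prop :=
  exists gr : 'I_d -> fn, forall i, avail S (gr i) /\
    forall x, gr i x = L (fun k => partial i (cell_fun es k) x) x.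

Lemma partial_cell_out es i x k : (size es <= k)%N -> partial i (cell_fun es k)
  x = 0.
Proof. by move=> le; rewrite /cell_fun nth_default // partial_cst. Qed.

(** Cells are removed from the last one backwards, and the adjoint of the removed cell is passed on
    to its operands. Reading the adjoints as a functional covers coinciding operands without a
    special case. The factor 4 comes from the product rule: two products and two additions. *)
Lemma reach_sweep es S L : tape es -> (forall k, avail S (cell_fun es k)) ->
  adjoint (size es) L S ->
  reach true (gradient_avail L es) (4 * (size es - d)) S.
Proof.
move=> tp; elim: tp S L => {es} [|es o tp IH ok] S L av [adj [avj Hadj]].
  (* Only inputs remain; their partial derivatives are Kronecker deltas, so the adjoints form the
     gradient. *)
  apply: reach_done; exists (fun i => adj i) => i; split=> // x.
  rewrite -Hadj; last by move=> k; apply: partial_cell_out.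
  rewrite size_input_cells (bigD1 i) //= cell_fun_input partial_coord eqxx
    mulr1.
  rewrite big1 ?addr0 // => j /negPf ji.
  by rewrite cell_fun_input partial_coord ji mulr0.
set n := size es; set a := adj n.
have avn k S' : extends S S' -> avail S' (cell_fun es k).
  move=> le; have [lt|ge] := ltnP k n.
    by have := avail_extends le (av k); rewrite /cell_fun nth_rcons lt.
  by rewrite /cell_fun nth_default //; apply: avail0.
have ava S' : extends S S' -> avail S' a by move=> le;
  apply: avail_extends le (avj n).
have ad0 : adjoint n (fun w x => \sum_(k < n) adj k x * w k) S by exists adj.
(* The share of the removed cell in the functional, expressed on its operands. *)
pose tail (w : nat -> R) (x : 'rV[R]_d) : R := match o with
  | IAdd i j => a x * w i + a x * w j
  | ISub i j => a x * w i - a x * w j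
  | IMul i j => (a x * cell_fun es j x) * w i + (a x * cell_fun es i x) * w j
  | _ => 0 end.
suff H : reach true (adjoint n (fun w x =>
  \sum_(k < n) adj k x * w k + tail w x)) 4 S.
  apply: (reach_bind H (n2 := 4 * (n - d))); last first.
    by rewrite size_rcons subSn ?tape_size // mulnS.
  move=> S' le adS'; apply: reach_weaken (IH _ _ _ adS') _; first by move=> k;
    apply: avn.
  move=> S2 le2 [gr Hgr]; exists gr => i; split; first by case: (Hgr i).
  move=> x; have [_ ->] := Hgr i.
  rewrite -Hadj; last by move=> k; apply: partial_cell_out.
  rewrite size_rcons big_ord_recr /=; congr (_ + _).
    apply: eq_bigr => k _; congr (_ * partial _ _ _).
    by rewrite /cell_fun nth_rcons (ltn_ord k).
  rewrite -/n -/a; have -> : cell_fun (rcons es (instr_fun o es)) n = instr_fun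
    o es.
    by rewrite /cell_fun nth_rcons ltnn eqxx.
  have el k := tape_elementary k tp.
  rewrite /tail; case: (o) ok => //= [c|j k|j k|j k] _.
  - by rewrite (_ : instr_fun _ _ = fun=> c) // partial_cst mulr0.
  - by rewrite [partial i (instr_fun _ _) x](partialD i x (el j) (el k)) mulrDr.
  - by rewrite [partial i (instr_fun _ _) x](partialB i x (el j) (el k)) mulrBr.
  - by rewrite [partial i (instr_fun _ _) x](partialM i x (el j) (el k)); ring.
rewrite /tail; case: (o) ok => //= [c|j k|j k|j k] _.
- by apply: reach_done; apply: adjoint_eq ad0 => x w _; rewrite addr0.
- apply: (reach_bind (reach_adjointD j ad0 (ava _ (extends_refl S))) (n2 := 1))
    => // S1 le1 ad1.
  apply: reach_weaken (reach_adjointD k ad1 (ava _ le1)) _ => S2 _.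
  by apply: adjoint_eq => x w _; rewrite addrA.
- apply: (reach_bind (reach_adjointD j ad0 (ava _ (extends_refl S))) (n2 := 1))
    => // S1 le1 ad1.
  apply: reach_weaken (reach_adjointB k ad1 (ava _ le1)) _ => S2 _.
  by apply: adjoint_eq => x w _; rewrite addrA.
- apply: (reach_bind (reach_mul true (ava _ (extends_refl S)) (avn k _
    (extends_refl S))) (n2 := 3)) => // S1 le1 av1.
  apply: (reach_bind (reach_adjointD j (adjoint_extends le1 ad0) av1) (n2 := 2))
    => // S2 le2 ad2.
  have {}le2 := extends_trans le1 le2.
  apply: (reach_bind (reach_mul true (ava _ le2) (avn j _ le2)) (n2 := 1)) =>
    // S3 le3 av3.
  apply: reach_weaken (reach_adjointD k (adjoint_extends le3 ad2) av3) _ =>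
    S4 _.
  by apply: adjoint_eq => x w _; rewrite addrA.
Qed.

End Reverse.

(** * Differentiating a whole computation tree *)

Section Differentiation.
Variables (R : realType) (d T : nat) (C : 'rV[R]_T -> R) (dC : 'rV[R]_T ->
  'rV[R]_T).
Variables (PC : program R).
Local Notation fn := ('rV[R]_d -> R).
Hypotheses (selC : elementary_selection C dC) (compC : computes PC C dC).

Definition cost_leaf (f : fn) (S : state R d) : Prop :=
  exists (a b : fn) (z : 'I_T -> fn),
    [/\ avail S a, avail S b, forall t, avail S (z t)
      & forall x, dom S x -> f x = a x - C (\row_t z t x) * b x].

Lemma reach_cost S (z : 'I_T -> fn) : (forall t, avail S (z t)) ->
  reach true (fun S' => avail S' (fun x => C (\row_t z t x)) /\
    forall t, avail S' (fun x => dC (\row_t z t x) 0 t)) (cost PC) S.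
Proof.
move=> avz; set Z := fun x => \row_t z t x.
have szz : size [seq z t | t <- enum 'I_T] = T by rewrite size_map
  size_enum_ord.
have avz' k : avail S (cell_fun [seq z t | t <- enum 'I_T] k).
  have [lt|ge] := ltnP k T; last first.
    by rewrite /cell_fun nth_default ?szz //; apply: avail0.
  rewrite /cell_fun (nth_map (Ordinal lt)) ?size_enum_ord //; exact: avz.
have rz x : dom S x -> run PC (memory_at x [seq z t | t <- enum 'I_T]) =
    Some (C (Z x) :: coords (dC (Z x))).
  move=> _; rewrite -compC; congr run; rewrite /memory_at -map_comp.
  by apply: eq_map => t /=; rewrite mxE.
apply: reach_weaken (reach_run avz' rz) _ => S' le [a Ha].
(* The list of output addresses is totalized by an address past the end, which reads zero. *)
have nthE x k : dom S' x ->
    cell_fun (cells S') (nth (size (cells S')) a k) x = (C (Z x) :: coords (dC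
      (Z x)))`_k.
  move=> Dx; rewrite Ha //; have [lt|ge] := ltnP k (size a).
    by rewrite (nth_map (size (cells S'))).
  by rewrite [nth _ a k]nth_default // nth_default ?size_map // /cell_fun
    nth_default.
split; first by exists (nth (size (cells S')) a 0) => x Dx; rewrite nthE.
move=> t; exists (nth (size (cells S')) a t.+1) => x Dx; rewrite nthE //=.
by rewrite /coords (nth_map t) ?size_enum_ord // nth_ord_enum.
Qed.

(** Six instructions form the value and seed the adjoints of [a] and [b], two per period seed [z],
    and the sweep takes four per computed cell. [M] bounds the tape uniformly over the leaves. *)
Lemma reach_leaf f S M : tape (cells S) -> (size (cells S) <= M)%N ->
  cost_leaf f S ->
  exists Df, selection_on (dom S) f Df /\
    reach true (outputs (fun x => f x :: coords (Df x)))
      (cost PC + 6 + 2 * T + 4 * (M - d)) S.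
Proof.
move=> tp leM [a0 [b0 [z0 [[ia Ea] [ib Eb] /choice [iz Ez] Ef]]]].
set es := cells S; pose a := cell_fun es ia; pose b := cell_fun es ib.
pose z t := cell_fun es (iz t).
have {}Ef x : dom S x -> f x = a x - C (\row_t z t x) * b x.
  move=> Dx; rewrite Ef // /a /b Ea // Eb //; congr (_ - C _ * _).
  by apply/rowP => t; rewrite !mxE /z Ez.
have ez t : elementary (z t) by apply: tape_elementary.
have sel := selection_on_leaf (dom S) selC (tape_elementary ia tp)
  (tape_elementary ib tp) ez.
move: sel; set Df := (X in selection_on _ _ X) => sel; exists Df; split.
  by apply: selection_on_eq sel => x Dx; rewrite Ef.
have av S' k : extends S S' -> avail S' (cell_fun es k).
  by move=> le; apply: avail_extends le (avail_cell S k).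
have avS S1 S2 g := @avail_extends R d S1 S2 g.
have tr S1 S2 S3 := @extends_trans R d S1 S2 S3.
set Cz := fun x => C (\row_t z t x).
pose dCz t x := dC (\row_t z t x) 0 t.
set c := (2 * T + 4 * (M - d))%N; rewrite -addnA -/c -addnA.
apply: (reach_bind (@reach_cost S z _) (n2 := 6 + c)) => [t|S1 l1 [aC adC]|].
- exact: av (extends_refl S).
- apply: (reach_bind (reach_mul true aC (av S1 ib l1)) (n2 := 5 + c)) =>
    // S2 l2 aCb.
  have {}l2' := tr _ _ _ l1 l2.
  apply: (reach_bind (reach_sub true (av S2 ia l2') aCb) (n2 := 4 + c)) =>
    // S3 l3 af.
  have l13 := tr _ _ _ l2 l3; have l03 := tr _ _ _ l1 l13.
  apply: (reach_bind (reach_sub true (avail0 S3) (avS _ _ _ l13 aC)) (n2 := 3 +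
    c)) => // S4 l4 anC.
  apply: (reach_bind (reach_const true S4 1) (n2 := 2 + c)) => // S5 l5 a1.
  have ad0 := adjoint0 (size es) S5.
  apply: (reach_bind (reach_adjointD ia ad0 a1) (n2 := 1 + c)) => // S6 l6 ad1.
  have l46 := tr _ _ _ l5 l6.
  apply: (reach_bind (reach_adjointD ib ad1 (avS _ _ _ l46 anC)) (n2 := c)) =>
    // S7 l7 ad2.
  have l37 := tr _ _ _ l4 (tr _ _ _ l46 l7).
  have l07 := tr _ _ _ l03 l37; have l17 := tr _ _ _ l13 l37.
  pose L0 (w : nat -> R) (x : 'rV[R]_d) := a x * 0 + w ia + (0 - Cz x) * w ib.
  have {}ad2 : adjoint (size es) L0 S7.
    by apply: adjoint_eq ad2 => x w _; rewrite /L0 mulr0 mul1r.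
  pose L (r : seq 'I_T) w x := L0 w x - \sum_(t <- r) b x * dCz t x * w (iz t).
  have loop (r : seq 'I_T) S' : extends S7 S' -> reach true (adjoint (size es)
    (L r)) (2 * size r) S'.
    elim: r S' => [|t r IH] S' le.
      apply: reach_done; apply: adjoint_eq (adjoint_extends le ad2) => x w _.
      by rewrite /L big_nil subr0.
    apply: (reach_bind (IH _ le) (n2 := 2)) => [S8 l8 ad3|];
      last by rewrite /= mulnS addnC.
    have l78 := tr _ _ _ le l8.
    apply: (reach_bind (reach_mul true (av S8 ib (tr _ _ _ l07 l78))
       (avS _ _ _ (tr _ _ _ l17 l78) (adC t))) (n2 := 1)) => // S9 l9 av9.
    apply: reach_weaken (reach_adjointB (iz t) (adjoint_extends l9 ad3) av9) _
      => S10 _.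
    by apply: adjoint_eq => x w _; rewrite /L big_cons opprD [RHS]addrA addrAC.
  have loopT : reach true (adjoint (size es) (L (enum 'I_T))) (2 * T) S7.
    by have := loop (enum 'I_T) S7 (extends_refl _); rewrite size_enum_ord.
  apply: (reach_bind loopT (n2 := 4 * (M - d))) => // S8 l8 ad3.
  have av8 k : avail S8 (cell_fun es k) by apply: av; apply: tr l07 l8.
  apply: (reach_bind (reach_sweep tp av8 ad3) (n2 := 0)); last first.
    by rewrite addn0 leq_mul2l /= leq_sub2r.
  move=> S9 l9 [gr Hgr]; apply: reach_done.
  have l39 := tr _ _ _ l37 (tr _ _ _ l8 l9); have l09 := tr _ _ _ l03 l39.
  have af9 : avail S9 f.
    apply: avail_eq (avS _ _ _ l39 af) _ => x Dx; rewrite Ef //; exact: l09.2.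
  apply: outputs_cons af9 _.
  have := @outputs_avail _ _ _ (enum 'I_d) gr S9 (fun i => (Hgr i).1).
  rewrite (_ : (fun x => [seq gr i x | i <- enum 'I_d]) = fun x =>
    coords (Df x)) //.
  apply/funext => x; apply: eq_map => i; have [_ ->] := Hgr i.
  rewrite /L /L0 mxE mulr0 !add0r; congr (_ - _).
  by rewrite big_enum.
- by rewrite addnA.
Qed.

(** Each leaf is continued by its own sweep, and the derivative is glued along the very comparisons
    of the tree, so that program and selection agree. *)
Lemma reach_differentiate f n S M : reach false (cost_leaf f) n S ->
  tape (cells S) -> (size (cells S) + n <= M)%N ->
  exists Df, selection_on (dom S) f Df /\
    reach true (outputs (fun x => f x :: coords (Df x)))
      (n + (cost PC + 6 + 2 * T + 4 * (M - d))) S.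
Proof.
elim=> {n S} [n S lf|n es D o ok ex _ IH|n es D i j _ IH1 _ IH2] tp leM.
- have [|Df [sel r]] := @reach_leaf f S M tp _ lf.
    by apply: leq_trans leM; apply: leq_addr.
  by exists Df; split=> //; apply: reach_leq r; apply: leq_addl.
- have [||Df [sel r]] := IH; first exact: tape_rcons.
    by rewrite /= size_rcons addSnnS.
  exists Df; split=> //.
  by rewrite addSn; apply: (@reach_do _ _ _ _ _ _ _ o) => //; rewrite orbT.
- have leM' : (size es + n <= M)%N by apply: leq_trans leM; rewrite addnS.
  have [D1 [s1 r1]] := IH1 tp leM'; have [D2 [s2 r2]] := IH2 tp leM'.
  exists (fun x => if cell_fun es i x <= cell_fun es j x then D1 x else D2 x);
    split.
    by apply: selection_on_cond => //; apply: tape_elementary.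
  rewrite addSn; apply: (@reach_if _ _ _ _ _ _ _ i j).
    apply: reach_weaken r1 _ => S' [_ le] [ad H]; exists ad => x Dx.
    by have [_ /= lex] := le x Dx; rewrite lex H.
  apply: reach_weaken r2 _ => S' [_ le] [ad H]; exists ad => x Dx.
  by have [_ /= ltx] := le x Dx; rewrite leNgt ltx H.
Qed.

Definition input_state : state R d := State (input_cells R d) setT.

Theorem reach_elementary_selection f n : continuous f ->
  reach false (cost_leaf f) n input_state ->
  exists Df, elementary_selection f Df /\
    exists P, computes P f Df /\ (cost P <= 5 * n + 2 * T + cost PC + 6)%N.
Proof.
move=> cf r.
(* The sweep then visits at most [n] computed cells, whence [n + 4 * n] instructions. *)
have [|Df [sel rD]] := reach_differentiate (M := d + n) r (tape_input R d).
  by rewrite /= size_input_cells.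
exists Df; split; first exact: selection_onT.
have [P [cP HP]] := reach_program rD; exists P; split; last first.
  apply: leq_trans cP _; rewrite addnC addKn; lia.
move=> x; rewrite -HP //; congr run;
  rewrite /memory_at /= /input_cells -map_comp.
exact: eq_map.
Qed.

End Differentiation.

(** * Projections and the variational inequality *)

Section Projection.
Variable R : realType.

Definition clip (a b u : R) : R := Num.max a (Num.min u b).

Lemma clipE a b u : a <= b ->
  clip a b u = if u <= a then a else if b <= u then b else u.
Proof.
move=> ab; rewrite /clip; case: (leP u b) => ub.
  case: (leP a u) => au; case: (leP u a) => ua; case: (leP b u) => bu //; lra.
by rewrite (max_idPr ab) (ltW ub); case: (leP u a) => ua //; lra.
Qed.

Lemma clip_itv a b u : a <= b -> a <= clip a b u <= b.
Proof.
move=> ab; rewrite clipE //.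
by case: (leP u a) => ua; [|case: (leP b u) => bu]; apply/andP; split; lra.
Qed.

Lemma clip_variational a b u y : a <= y <= b ->
  (u - clip a b u) * (y - clip a b u) <= 0.
Proof.
move=> /andP[ay yb]; rewrite clipE; last exact: le_trans yb.
case: (leP u a) => ua; [|case: (leP b u) => bu].
- by apply: mulr_le0_ge0; lra.
- by apply: mulr_ge0_le0; lra.
- by rewrite subrr mul0r.
Qed.

Lemma clip_lipschitz a b u v : a <= b -> `|clip a b u - clip a b v| <= `|u - v|.
Proof.
move=> ab; rewrite !clipE //.
case: (leP u a) => ua; [|case: (leP b u) => bu];
case: (leP v a) => va; [|case: (leP b v) => bv| |case: (leP b v) =>
  bv| |case: (leP b v) => bv];
by rewrite ler_norml; case: (ger0P (u - v)) => uv; apply/andP; split; lra.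
Qed.

Lemma clip_le (a b v w : R) : a <= b -> v <= w -> clip a b v <= clip a b w.
Proof.
move=> ab vw; rewrite !clipE //.
case: (leP v a) => ?; [|case: (leP b v) => ?];
(case: (leP w a) => ?; [|case: (leP b w) => ?]); lra.
Qed.

Lemma projR_itv (a b u : R) : a <= b -> projR `[a, b] u = clip a b u.
Proof.
move=> ab; rewrite /projR; set A := [set x | _].
have Ac : A (clip a b u).
  split; first by rewrite /= in_itv /= clip_itv.
  move=> y; rewrite /= in_itv /= => /andP[ay yb]; rewrite clipE //.
  case: (leP u a) => ua; [|case: (leP b u) => bu];
  by case: (ger0P (u - y)) => uy; rewrite ler_norml; apply/andP; split; lra.
case: xgetP => [x _ [xab xmin]|/(_ _ Ac)//].
have := xmin _ Ac.1; move: xab; rewrite /= in_itv /= => /andP[ax xb];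
  rewrite clipE //.
case: (leP u a) => ua; [|case: (leP b u) => bu].
- by rewrite !ler0_norm; lra.
- by rewrite !ger0_norm; lra.
- by rewrite subrr normr0 normr_le0 subr_eq0 => /eqP.
Qed.

Lemma continuous_sum (U : topologicalType) (V : normedModType R) (I : Type)
    (r : seq I) (P : pred I) (f : I -> U -> V) :
  (forall i, P i -> continuous (f i)) ->
  continuous (fun w => \sum_(i <- r | P i) f i w).
Proof.
move=> cf; elim: r => [|i r IH] w0.
  under eq_fun do rewrite big_nil; exact: cst_continuous.
under eq_fun do rewrite big_cons; case: (boolP (P i)) => Pi; last exact: IH.
by apply: (continuousD (cf i Pi w0) (IH w0)).
Qed.

Lemma continuous_add (U : topologicalType) (f g : U -> R) :
  continuous f -> continuous g -> continuous (fun w => f w + g w).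
Proof. by move=> cf cg w; apply: (continuousD (cf w) (cg w)). Qed.

Lemma continuous_sub (U : topologicalType) (f g : U -> R) :
  continuous f -> continuous g -> continuous (fun w => f w - g w).
Proof. by move=> cf cg w; apply: (continuousB (cf w) (cg w)). Qed.

Lemma continuous_mul (U : topologicalType) (f g : U -> R) :
  continuous f -> continuous g -> continuous (fun w => f w * g w).
Proof. by move=> cf cg w; apply: (continuousM (cf w) (cg w)). Qed.

Lemma continuous_row (U : topologicalType) n (z : 'I_n -> U -> R) :
  (forall t, continuous (z t)) -> continuous (fun w => \row_t z t w).
Proof.
move=> cz; rewrite (_ : (fun w => _) =
    fun w => \sum_t z t w *: (delta_mx 0 t : 'rV[R]_n)).
  apply: continuous_sum => t _ w.
  apply: (@continuous_comp _ _ _ (z t) (fun k =>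
    k *: (delta_mx 0 t : 'rV[R]_n)) w).
    exact: cz.
  exact: scalel_continuous.
apply/funext => w; apply/rowP => t.
rewrite !mxE summxE (bigD1 t) //= !mxE !eqxx mulr1 big1 ?addr0 // =>
  s /negPf st.
by rewrite !mxE eq_sym st andbF mulr0.
Qed.

(** * Projections through the variational inequality, and their nonexpansiveness *)

Section Variational.
Variable d : nat.
Implicit Types (A : set 'rV[R]_d) (u v x y : 'rV[R]_d).

Definition variational A u x : Prop :=
  A x /\ forall y, A y -> \sum_i (u 0 i - x 0 i) * (y 0 i - x 0 i) <= 0.

Lemma norm2_le u v : (norm2 u <= norm2 v) = (\sum_i u 0 i ^+ 2 <= \sum_i v 0 i
  ^+ 2).
Proof. by rewrite /norm2 ler_sqrt // sumr_ge0 // => i _; apply: sqr_ge0. Qed.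

Lemma variational_le A u x y : variational A u x -> A y ->
  \sum_i (u - x) 0 i ^+ 2 + \sum_i (y - x) 0 i ^+ 2 <= \sum_i (u - y) 0 i ^+ 2.
Proof.
move=> [_ Hx] /Hx le; rewrite -subr_ge0 -big_split -sumrB /=.
rewrite (eq_bigr (fun i => - 2 * ((u 0 i - x 0 i) * (y 0 i - x 0 i)))).
  by rewrite -mulr_sumr; nra.
by move=> i _; rewrite !mxE; ring.
Qed.

(** The obtuse angle inequality makes [x] at once a nearest point and the only one, which pins down
    the choice made by [xget]. *)
Lemma proj_variational A u x : variational A u x -> Defs.proj A u = x.
Proof.
move=> vx; rewrite /Defs.proj; set B := [set x | _].
have Bx : B x.
  split=> [|y Ay]; first by case: vx.
  rewrite norm2_le; apply: le_trans (variational_le vx Ay).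
  by rewrite lerDl sumr_ge0 // => i _; apply: sqr_ge0.
case: xgetP => [y _ [Ay ymin]|/(_ _ Bx)//].
have := ymin x vx.1; rewrite norm2_le => le.
have := le_trans (variational_le vx Ay) le; rewrite gerDl => le0.
apply/rowP => i; apply/eqP; rewrite -subr_eq0 -sqrf_eq0.
have ge j : xpredT j -> 0 <= (y - x) 0 j ^+ 2 by rewrite sqr_ge0.
have z : \sum_j (y - x) 0 j ^+ 2 = 0 by apply/le_anti; rewrite le0 sumr_ge0.
by have := psumr_eq0P ge z (i := i); rewrite !mxE => -> //.
Qed.

(** Each variational inequality is tested at the other projection, and the two are added. *)
Lemma variational_nonexpansive A u v x y : variational A u x -> variational A v
  y ->
  \sum_i (x 0 i - y 0 i) ^+ 2 <= \sum_i (u 0 i - v 0 i) ^+ 2.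
Proof.
move=> [Ax Hx] [Ay Hy]; have := Hx _ Ay; have := Hy _ Ax => h1 h2.
have : 0 <= \sum_i (u 0 i - v 0 i - (x 0 i - y 0 i)) ^+ 2.
  by rewrite sumr_ge0 // => i _; apply: sqr_ge0.
rewrite (eq_bigr (fun i => (u 0 i - v 0 i) ^+ 2 - (x 0 i - y 0 i) ^+ 2 +
   2 * ((v 0 i - y 0 i) * (x 0 i - y 0 i) + (u 0 i - x 0 i) * (y 0 i - x 0
     i)))).
  by rewrite big_split /= sumrB -mulr_sumr big_split /=; lra.
by move=> i _; ring.
Qed.

(** The l1 distance dominates the Euclidean one and is visibly continuous coordinate by coordinate,
    as [continuous_proj] wants it. *)
Lemma variational_lipschitz A u v x y : variational A u x -> variational A v y
  ->
  forall i, `|x 0 i - y 0 i| <= \sum_j `|u 0 j - v 0 j|.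
Proof.
move=> vx vy i; have := variational_nonexpansive vx vy => le.
have ge0 : 0 <= \sum_j `|u 0 j - v 0 j| by apply: sumr_ge0.
rewrite -(@ler_pXn2r _ 2) ?nnegrE // real_normK ?num_real //.
have le1 : (x 0 i - y 0 i) ^+ 2 <= \sum_i (x 0 i - y 0 i) ^+ 2.
  by rewrite (bigD1 i) //= lerDl sumr_ge0 // => j _; apply: sqr_ge0.
apply: le_trans (le_trans le1 le) _.
rewrite [leRHS]expr2 mulr_suml; apply: ler_sum => j _.
rewrite -real_normK ?num_real // expr2; apply: ler_wpM2l => //.
by rewrite (bigD1 j) //= lerDl sumr_ge0.
Qed.

Lemma proj_id A x : A x -> Defs.proj A x = x.
Proof.
move=> Ax; apply: proj_variational; split=> // y _.
by rewrite big1 // => i _; rewrite subrr mul0r.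
Qed.

Lemma continuous_proj (U : topologicalType) A (f : U -> 'rV[R]_d) :
  (forall u, exists x, variational A u x) ->
  (forall i, continuous (fun w => f w 0 i)) ->
  forall i, continuous (fun w => Defs.proj A (f w) 0 i).
Proof.
move=> ex cf i w0; apply/cvgrPdist_lt => e e0.
have ce : continuous (fun w => \sum_j `|f w0 0 j - f w 0 j|).
  apply: continuous_sum => j _ w1; apply: cvg_norm; apply: cvgB;
    first exact: cvg_cst.
  exact: cf.
have /cvgrPdist_lt /(_ e e0) := ce w0.
apply: filterS => w; rewrite [X in X - _]big1; last by move=> j _;
  rewrite subrr normr0.
rewrite sub0r normrN ger0_norm; last exact: sumr_ge0.
apply: le_lt_trans; have [x vx] := ex (f w0); have [y vy] := ex (f w).
by rewrite (proj_variational vx) (proj_variational vy);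
  apply: variational_lipschitz vx vy i.
Qed.

End Variational.

Lemma continuous_clip (U : topologicalType) a b (f : U -> R) : a <= b ->
  continuous f -> continuous (fun u => clip a b (f u)).
Proof.
move=> ab cf u0; apply/cvgrPdist_lt => e e0.
have /cvgrPdist_lt /(_ e e0) := cf u0.
by apply: filterS => u; apply: le_lt_trans; apply: clip_lipschitz.
Qed.

Lemma proj_box d (Lam : R) (u : 'rV[R]_d) : 0 <= Lam ->
  Defs.proj (box Lam) u = \row_i clip (- Lam) Lam (u 0 i).
Proof.
move=> L0; apply: proj_variational; split=> [i|y By].
  by rewrite mxE; apply: clip_itv; lra.
by apply: sumr_le0 => i _; rewrite mxE; apply: clip_variational.
Qed.

End Projection.

(** * Searching, sorting and clipping *)

Section Search.
Variables (R : realType) (d : nat).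
Local Notation fn := ('rV[R]_d -> R).
Implicit Types (S : state R d) (g h f : fn).

(** The invariant is that [B] holds at [lo] and fails at [hi] for all inputs of the node, so the
    search ends at an adjacent change of [B]. *)
Lemma reach_bsearch full (B : nat -> 'rV[R]_d -> Prop) c k lo hi S :
  (forall i S', (lo < i < hi)%N -> extends S S' ->
    reach full (fun S'' => (forall x, dom S'' x -> B i x) \/
                           (forall x, dom S'' x -> ~ B i x)) c S') ->
  (lo < hi)%N -> (hi - lo <= 2 ^ k)%N ->
  (forall x, dom S x -> B lo x) -> (forall x, dom S x -> ~ B hi x) ->
  reach full (fun S' => exists j, (lo <= j < hi)%N /\
    forall x, dom S' x -> B j x /\ ~ B j.+1 x) (k * c) S.
Proof.
elim: k lo hi S => [|k IH] lo hi S test lt le Blo Bhi.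
  have hiE : hi = lo.+1 by rewrite expn0 in le; lia.
  apply: reach_done; exists lo; rewrite leqnn lt; split=> // x Dx.
  by rewrite -hiE; split; [apply: Blo|apply: Bhi].
have [le'|gt] := leqP (hi - lo) (2 ^ k).
  by apply: reach_leq (IH lo hi S test lt le' Blo Bhi); rewrite mulSn leq_addl.
have pk : (0 < 2 ^ k)%N by rewrite expn_gt0.
have le2 : (hi - lo <= 2 ^ k + 2 ^ k)%N by rewrite addnn -mul2n -expnS.
(* Taking exactly [2 ^ k] positions on the left leaves at most as many on the right. *)
set mid := (lo + 2 ^ k)%N; have mid_in : (lo < mid < hi)%N by rewrite /mid; lia.
have sub S' S'' : extends S S' -> extends S' S'' -> extends S S''.
  exact: extends_trans.
apply: (reach_bind (test mid S mid_in (extends_refl S)) (n2 := k * c)) => //.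
move=> S1 le1 [Bm|nBm].
  apply: reach_weaken (IH mid hi S1 _ _ _ Bm _) _; rewrite /mid.
  - by move=> i S' ii /(sub _ _ le1); apply: test; rewrite /mid in ii mid_in;
      lia.
  - by rewrite /mid in mid_in; lia.
  - by rewrite /mid in mid_in; lia.
  - by move=> x Dx; apply: Bhi; apply: le1.2.
  - by move=> S' _ [j [jj H]]; exists j; split=> //; lia.
apply: reach_weaken (IH lo mid S1 _ _ _ _ nBm) _.
- by move=> i S' ii /(sub _ _ le1); apply: test; rewrite /mid in ii mid_in; lia.
- by rewrite /mid in mid_in *; lia.
- by rewrite /mid in mid_in *; lia.
- by move=> x Dx; apply: Blo; apply: le1.2.
- by move=> S' _ [j [jj H]]; exists j; split=> //; rewrite /mid in jj mid_in;
    lia.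
Qed.

(** * Sorting by binary insertion *)

Section Sort.
Variables (I : eqType) (key : I -> fn).

Definition ordered (x : 'rV[R]_d) (s : seq I) : bool :=
  pairwise (fun i j => key i x <= key j x) s.

(** The list is known at the node, so shifting its entries is free and only the search for the
    position is paid for. *)
Lemma reach_insert full (s : seq I) v k S :
  (forall x, dom S x -> ordered x s) ->
  (forall i, i \in v :: s -> avail S (key i)) -> (size s < 2 ^ k)%N ->
  reach full (fun S' => exists s', perm_eq s' (v :: s) /\
    forall x, dom S' x -> ordered x s') k S.
Proof.
move=> os av lt.
(* The bound on [j] makes [B] fail one past [size s], the right end of the bisection; at 0 it holds
   vacuously. *)
pose B j x := (j <= size s)%N /\ forall i, (i < j)%N -> key (nth v s i) x <= key
  v x.
have test i S' : (0 < i < (size s).+1)%N -> extends S S' ->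
    reach full (fun S'' => (forall x, dom S'' x -> B i x) \/
                           (forall x, dom S'' x -> ~ B i x)) 1 S'.
  case: i => // i; rewrite ltnS /= => lti le.
  have avi : avail S' (key (nth v s i)).
    by apply: avail_extends le (av _ _); rewrite inE mem_nth ?orbT.
  have avv : avail S' (key v) by apply: avail_extends le (av _ _);
    rewrite inE eqxx.
  apply: reach_weaken (reach_cmp full avi avv) _ => S2 le2 [H|H];
    [left|right] => x Dx.
    split=> // j; rewrite ltnS leq_eqVlt => /orP[/eqP->|ltj]; first exact: H.
    apply: le_trans (H x Dx); have {}os := os x (le.2 _ (le2.2 _ Dx)).
    by move/(pairwiseP v): os; apply=> //;
      rewrite inE /= ?(ltn_trans ltj lti) ?lti.
  by move=> [_ /(_ i (leqnn _))]; rewrite leNgt H.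
apply: reach_leq _ (reach_weaken (reach_bsearch (k := k) test _ _ _ _) _) => //.
- by rewrite muln1.
- by move=> x _ []; rewrite ltnn.
move=> S' le [j [/andP[_ ltj] H]].
exists (take j s ++ v :: drop j s); split.
  by rewrite -cat1s perm_catCA cat1s perm_cons cat_take_drop.
move=> x Dx; have [Bj nBj] := H x Dx.
have := os x (le.2 _ Dx); rewrite /ordered -{1}(cat_take_drop j s)
  !pairwise_cat.
move=> /and3P[tda ta da]; rewrite ta /= da allrel_consr tda !andbT /=.
have lej : (j <= size s)%N by [].
apply/andP; split.
  apply/(all_nthP v) => i; rewrite size_take_min leq_min => /andP[lti _].
  by rewrite nth_take //; apply Bj.
have [eqj|ltj'] := eqVneq j (size s); first by rewrite eqj drop_size.
have {}ltj' : (j < size s)%N by rewrite ltn_neqAle ltj'.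
have vlt : key v x < key (nth v s j) x.
  rewrite ltNge; apply/negP => lejv; apply: nBj; split=> // i.
  rewrite ltnS leq_eqVlt => /orP[/eqP-> //|]; apply Bj.
move: da; rewrite (drop_nth v ltj') /= (ltW vlt) => /andP[/allP al _].
by apply/allP => w /al; apply: le_trans (ltW vlt).
Qed.

Lemma reach_sort full (r : seq I) k S :
  (forall i, i \in r -> avail S (key i)) -> (size r <= 2 ^ k)%N ->
  reach full (fun S' => exists s, perm_eq s r /\
    forall x, dom S' x -> ordered x s) (size r * k) S.
Proof.
elim: r S => [|v r IH] S av le; first by apply: reach_done; exists [::].
apply: (reach_bind (IH S _ (ltnW le)) (n2 := k));
  last by rewrite /= mulSn addnC.
  by move=> i ir; apply: av; rewrite inE ir orbT.
move=> S1 le1 [s [ps os]].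
apply: reach_weaken (reach_insert full (v := v) os _ _) _.
- move=> i ii; apply: avail_extends le1 (av i _); move: ii.
  by rewrite !inE (perm_mem ps).
- by rewrite (perm_size ps).
- move=> S' _ [s' [ps' os']]; exists s'; split=> //.
  by apply: perm_trans ps' _; rewrite perm_cons.
Qed.

End Sort.

Lemma reach_clip full g (a b : R) S : a <= b -> avail S g ->
  reach full (avail^~ (fun x : 'rV[R]_d => clip a b (g x))) 4 S.
Proof.
move=> ab avg.
apply: (reach_bind (reach_const full S a) (n2 := 3)) => // S1 l1 ava.
apply: (reach_bind (reach_const full S1 b) (n2 := 2)) => // S2 l2 avb.
have {}ava := avail_extends l2 ava.
have {}avg := avail_extends (extends_trans l1 l2) avg.
apply: (reach_bind (reach_cmp full avg ava) (n2 := 1)) => // S3 l3 [H|H].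
  apply/reach_done/(avail_eq (avail_extends l3 ava)) => x Dx.
  by rewrite clipE // H.
apply: reach_weaken (reach_cmp full (avail_extends l3 avb) (avail_extends l3
  avg)) _.
move=> S4 l4 [H'|H'].
  apply: avail_eq (avail_extends (extends_trans l3 l4) avb) _ => x Dx.
  by rewrite clipE // leNgt H ?H' //; apply: l4.2.
apply: avail_eq (avail_extends (extends_trans l3 l4) avg) _ => x Dx.
by rewrite clipE // leNgt H ?leNgt ?H' //; apply: l4.2.
Qed.

End Search.

(** * Projection onto a box cut by a hyperplane *)

Section Knapsack.
Variables (R : realType) (d : nat) (J : eqType).
Local Notation fn := ('rV[R]_d -> R).
Implicit Types (S : state R d) (g h f : fn).

(* KKT conditions of the projection of [y] onto the box [lb, ub] cut by the
   hyperplane of sum [s]; [lam] is the multiplier of the sum constraint. *)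
Definition knapsack (r : seq J) (lb ub : J -> R) (s : R) (y z : J -> R) : Prop
  :=
  \sum_(t <- r) z t = s /\
  exists lam, forall t, t \in r -> z t = clip (lb t) (ub t) (y t - lam).

Lemma knapsack_itv r lb ub s y z : (forall t, t \in r -> lb t <= ub t) ->
  knapsack r lb ub s y z -> forall t, t \in r -> lb t <= z t <= ub t.
Proof. by move=> lu [_ [lam H]] t tr; rewrite H // clip_itv // lu. Qed.

(** Both [w] and [z] have sum [s], so shifting [y] by the multiplier leaves the sum unchanged; after
    the shift the inequality holds coordinatewise by clipping. *)
Lemma knapsack_variational r lb ub s y z w :
  knapsack r lb ub s y z ->
  (forall t, t \in r -> lb t <= w t <= ub t) -> \sum_(t <- r) w t = s ->
  \sum_(t <- r) (y t - z t) * (w t - z t) <= 0.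
Proof.
move=> [sz [lam H]] wb sw.
have -> : \sum_(t <- r) (y t - z t) * (w t - z t) =
    \sum_(t <- r) (y t - lam - z t) * (w t - z t).
  apply/eqP; rewrite -subr_eq0 -sumrB; apply/eqP.
  rewrite (eq_bigr (fun t => lam * (w t - z t))); last by move=> t _; ring.
  by rewrite -mulr_sumr sumrB sw sz subrr mulr0.
rewrite big_seq; apply: sumr_le0 => t tr; rewrite H //.
by apply: clip_variational; apply: wb.
Qed.

(** * Linear pieces of the dual function *)

Section Breakpoints.
Variables (r : seq J) (lb ub : J -> R) (s : R).
Hypothesis lu : forall t, t \in r -> lb t <= ub t.

(** As the multiplier grows, coordinate [i.1] leaves its upper bound at the [false] breakpoint and
    reaches its lower bound at the [true] one. *)
Definition breakpoint (y : J -> R) (i : J * bool) : R :=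
  y i.1 - (if i.2 then lb i.1 else ub i.1).

Definition breakpoints : seq (J * bool) := [seq (t, b) | t <- r, b <- [:: true;
  false]].

Lemma size_breakpoints : size breakpoints = (2 * size r)%N.
Proof. by rewrite size_allpairs mulnC. Qed.

Lemma mem_breakpoints t b : ((t, b) \in breakpoints) = (t \in r).
Proof.
apply/allpairsP/idP => [[[u c] /= [ur _ [-> _]]] //|tr].
by exists (t, b); split=> //; case: b.
Qed.

Variables (p : seq (J * bool)) (j : nat).
Hypothesis pP : perm_eq p breakpoints.

(* On an interval between consecutive breakpoints every coordinate stays at its
   upper bound, at its lower bound, or strictly between. *)
Definition at_ub t := (j < index (t, false) p)%N.
Definition at_lb t := (index (t, true) p <= j)%N.
Definition is_free t := ~~ at_ub t && ~~ at_lb t.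

Definition free_count : R := \sum_(t <- r) (is_free t)%:R.

Definition piece_base (y : J -> R) t : R :=
  if at_ub t then ub t else if at_lb t then lb t else y t.

(** Solves the sum constraint on the linear piece. [free_count] does not depend on [y], so its
    inverse can be a constant instruction. *)
Definition piece_multiplier (y : J -> R) : R :=
  (\sum_(t <- r) piece_base y t - s) * free_count^-1.

Definition piece_value (y : J -> R) (lam : R) t : R :=
  piece_base y t - (is_free t)%:R * lam.

Definition load_sum (y : J -> R) (lam : R) : R :=
  \sum_(t <- r) clip (lb t) (ub t) (y t - lam).

Variables (i0 : J * bool) (y : J -> R).
Let kappa i := breakpoint y (nth i0 p i).
Hypothesis ord_p : pairwise (fun a b => breakpoint y a <= breakpoint y b) p.
Hypothesis lt_j : (j.+1 < size p)%N.

Lemma kappa_le i i' : (i <= i')%N -> (i' < size p)%N -> kappa i <= kappa i'.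
Proof.
rewrite leq_eqVlt => /orP[/eqP-> //|lt] lt'.
by apply: (pairwiseP i0 ord_p) => //; rewrite inE //; apply: ltn_trans lt'.
Qed.

Lemma kappa_index t b : t \in r ->
  (index (t, b) p < size p)%N /\ kappa (index (t, b) p) = breakpoint y (t, b).
Proof.
move=> tr; have tp : (t, b) \in p by rewrite (perm_mem pP) mem_breakpoints.
by rewrite index_mem tp /kappa nth_index.
Qed.

(** The status of a coordinate is read off the ranks of its two breakpoints, and sortedness turns
    ranks into inequalities against [lam]. A coordinate marked both ways has equal bounds. *)
Lemma clip_piece lam t : t \in r -> kappa j <= lam <= kappa j.+1 ->
  clip (lb t) (ub t) (y t - lam) = piece_value y lam t.
Proof.
move=> tr /andP[l1 l2]; rewrite clipE ?lu // /piece_value /piece_base /is_free.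
have lut := lu tr.
have [lF eF] := kappa_index false tr; have [lT eT] := kappa_index true tr.
rewrite /breakpoint /= in eF eT.
case: (boolP (at_ub t)) => [hu|]; [|rewrite /at_ub -leqNgt => hu].
  have := kappa_le hu lF; rewrite eF /= mul0r subr0 => le.
  by case: (leP (y t - lam)) => ?; [|case: leP => ?]; lra.
case: (boolP (at_lb t)) => [hl|]; [|rewrite /at_lb -ltnNge => hl].
  have := kappa_le hl (ltnW lt_j); rewrite eT /= mul0r subr0 => le.
  by case: (leP (y t - lam)) => ?; [|case: leP => ?]; lra.
have := kappa_le hu (ltnW lt_j); have := kappa_le hl lT;
  rewrite eF eT /= mul1r => le le'.
by case: (leP (y t - lam)) => ?; [|case: leP => ?]; lra.
Qed.

Lemma sum_piece lam : \sum_(t <- r) piece_value y lam t =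
  \sum_(t <- r) piece_base y t - free_count * lam.
Proof. by rewrite sumrB -mulr_suml. Qed.

(** The load drops strictly between the two breakpoints, so at least one coordinate is free and the
    level [s] is crossed inside this piece. *)
Lemma piece_knapsack :
  s <= load_sum y (kappa j) -> load_sum y (kappa j.+1) < s ->
  knapsack r lb ub s y (piece_value y (piece_multiplier y)).
Proof.
have lek : kappa j <= kappa j.+1 by apply: kappa_le.
have load lam : kappa j <= lam <= kappa j.+1 ->
    load_sum y lam = \sum_(t <- r) piece_base y t - free_count * lam.
  move=> lamP; rewrite -sum_piece; apply: eq_big_seq => t tr; exact: clip_piece.
rewrite !load ?lek ?lexx //; set b := \sum_(t <- r) _;
  set f := free_count => h1 h2.
have f0 : 0 <= f by apply: sumr_ge0 => t _; apply: ler0n.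
have fpos : 0 < f.
  by rewrite lt_def f0 andbT; apply/eqP => fz; move: h1 h2; rewrite fz !mul0r;
    lra.
set lam := piece_multiplier y.
have lamE : f * lam = b - s by rewrite /lam /piece_multiplier -/f -/b mulrC
  divfK ?gt_eqF.
have lamP : kappa j <= lam <= kappa j.+1.
  by apply/andP; split; rewrite -(ler_pM2l fpos) lamE; lra.
split; first by rewrite sum_piece -/f -/b lamE; ring.
by exists lam => t tr; rewrite clip_piece.
Qed.

End Breakpoints.

Section Program.
Variables (r : seq J) (lb ub : J -> R) (s : R).
Hypothesis lu : forall t, t \in r -> lb t <= ub t.

Lemma load_sum_first y k : \sum_(t <- r) lb t < s < \sum_(t <- r) ub t ->
  (forall t, t \in r -> k <= y t - ub t) -> s <= load_sum r lb ub y k.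
Proof.
move=> /andP[_ /ltW le] H; apply: le_trans le _;
  rewrite /load_sum [leLHS]big_seq [leRHS]big_seq.
apply: ler_sum => t tr; rewrite clipE ?lu //.
by have := H t tr; have := lu tr; case: (leP (y t - k) (lb t)) => ?;
  [|case: (leP (ub t) (y t - k)) => ?]; lra.
Qed.

Lemma load_sum_last y k : \sum_(t <- r) lb t < s < \sum_(t <- r) ub t ->
  (forall t, t \in r -> y t - lb t <= k) -> load_sum r lb ub y k < s.
Proof.
move=> /andP[lt _] H; apply: le_lt_trans lt;
  rewrite /load_sum [leLHS]big_seq [leRHS]big_seq.
apply: ler_sum => t tr; rewrite clipE ?lu //.
by have := H t tr; have := lu tr; case: (leP (y t - k) (lb t)) => ?;
  [|case: (leP (ub t) (y t - k)) => ?]; lra.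
Qed.

(** The degenerate target admits no strict crossing, but any multiplier at least as large as every
    [y t - lb t] fits. *)
Lemma knapsack_lb y : \sum_(t <- r) lb t = s -> knapsack r lb ub s y lb.
Proof.
move=> e; split=> //; exists (\sum_(t <- r) `|y t - lb t|) => t tr.
have : `|y t - lb t| <= \sum_(t <- r) `|y t - lb t|.
  by rewrite (big_rem t) //= lerDl sumr_ge0.
have := ler_norm (y t - lb t); rewrite clipE ?lu // => h1 h2.
by have lut := lu tr; case: leP => ?; [|case: leP => ?]; lra.
Qed.

Lemma knapsack_ub y : \sum_(t <- r) ub t = s -> knapsack r lb ub s y ub.
Proof.
move=> e; split=> //; exists (- \sum_(t <- r) `|y t - ub t|) => t tr.
have : `|y t - ub t| <= \sum_(t <- r) `|y t - ub t|.
  by rewrite (big_rem t) //= lerDl sumr_ge0.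
have := ler_norm (ub t - y t); rewrite distrC clipE ?lu // => h1 h2.
by have lut := lu tr; case: leP => ?; [|case: leP => ?]; lra.
Qed.

Definition knapsack_avail (y : J -> fn) S : Prop :=
  exists z : J -> fn, (forall t, t \in r -> avail S (z t)) /\
    forall x, dom S x -> knapsack r lb ub s (y^~ x) (z^~ x).

Lemma reach_constants full (c : J -> R) S :
  reach full (fun S' => forall t, t \in r -> avail S' (fun=> c t)) (size r) S.
Proof.
rewrite -[X in reach _ _ X]muln1; apply: reach_each => [t|t S' _ _].
  exact: persistent_avail.
exact: reach_const.
Qed.

Lemma reach_load_sum full (y : J -> fn) (k : fn) S :
  (forall t, t \in r -> avail S (y t)) -> avail S k ->
  reach full (avail^~ (fun x => load_sum r lb ub (y^~ x) (k x))) (6 * size r) S.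
Proof.
move=> avy avk.
pose g t x := clip (lb t) (ub t) (y t x - k x).
apply: (@reach_bind _ _ _ (fun S' =>
  forall t, t \in r -> avail S' (g t)) _ (size r * 5) (size r)).
- apply: reach_each => [t|t S1 tr l1]; first exact: persistent_avail.
  apply: (reach_bind (reach_sub full (avail_extends l1 (avy t tr))
    (avail_extends l1 avk)) (n2 := 4)) => //.
  by move=> S2 l2 av2; apply: reach_clip av2; apply: lu.
- by move=> S1 l1; apply: reach_sum.
- by lia.
Qed.

Lemma reach_fixed full (y : J -> fn) (c : J -> R) S :
  (forall y, knapsack r lb ub s y c) ->
  reach full (knapsack_avail y) (size r) S.
Proof.
move=> H; apply: reach_weaken (reach_constants full c S) _ => S' _ av.
by exists (fun t => fun=> c t).
Qed.

Lemma reach_breakpoints full (y : J -> fn) S : (forall t, t \in r -> avail S (y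
  t)) ->
  reach full (fun S' => forall i, i \in breakpoints r ->
     avail S' (fun x => breakpoint lb ub (y^~ x) i)) (4 * size r) S.
Proof.
move=> avy; rewrite (_ : (4 * size r)%N = (size (breakpoints r) * 2)%N);
  last first.
  by rewrite size_breakpoints; lia.
apply: reach_each => [i|[t b] S1]; first exact: persistent_avail.
rewrite mem_breakpoints => tr l1.
apply: (reach_bind (reach_const full S1 (if b then lb t else ub t)) (n2 := 1))
  => // S2 l2.
by apply: reach_sub; apply: avail_extends (extends_trans l1 l2) (avy t tr).
Qed.

Lemma reach_piece full (y : J -> fn) p j S : (forall t, t \in r -> avail S (y
  t)) ->
  reach full (fun S' => forall t, t \in r ->
     avail S' (fun x => piece_value lb ub p j (y^~ x) (piece_multiplier r lb ub
       s p j (y^~ x)) t))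
   (8 * size r + 4) S.
Proof.
move=> avy.
have base S' : extends S S' -> reach full (fun S2 => forall t, t \in r ->
    avail S2 (fun x => piece_base lb ub p j (y^~ x) t)) (size r * 1) S'.
  move=> le; apply: reach_each => [t|t S1 tr l1]; first exact: persistent_avail.
  rewrite /piece_base; case: (at_ub p j t); first exact: reach_const.
  case: (at_lb p j t); first exact: reach_const.
  exact/reach_done/(avail_extends (extends_trans le l1))/avy.
apply: (reach_bind (base S (extends_refl S)) (n2 := 7 * size r + 4));
  last by lia.
move=> S1 l1 avb.
apply: (reach_bind (reach_sum full avb) (n2 := 6 * size r + 4)); last by lia.
move=> S2 l2 avs.
apply: (reach_bind (reach_const full S2 s) (n2 := 6 * size r + 3)); last by lia.
move=> S3 l3 avc.
apply: (reach_bind (reach_sub full (avail_extends l3 avs) avc) (n2 := 6 * size r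
  + 2)); last by lia.
move=> S4 l4 avd.
apply: (reach_bind (reach_const full S4 (free_count r p j)^-1) (n2 := 6 * size r
  + 1)); last by lia.
move=> S5 l5 avf.
apply: (reach_bind (reach_mul full (avail_extends l5 avd) avf) (n2 := size r *
  3)); last by lia.
move=> S6 l6 avm.
have l16 := extends_trans l2 (extends_trans l3 (extends_trans l4 (extends_trans
  l5 l6))).
apply: reach_each => [t|t S7 tr l7]; first exact: persistent_avail.
apply: (reach_bind (reach_const full S7 (is_free p j t)%:R) (n2 := 2)) =>
  // S8 l8 avi.
have l68 := extends_trans l7 l8.
apply: (reach_bind (reach_mul full avi (avail_extends l68 avm)) (n2 := 1)) =>
  // S9 l9 avim.
apply: reach_sub avim; apply: avail_extends (avb t tr).
exact: extends_trans l16 (extends_trans l68 l9).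
Qed.

(** Sorting takes [2 * size r * k] comparisons, bisection [k] load sums of linear cost, and the rest
    is linear; 40 covers the total. Whether [s] equals one of the bound sums is a matter of
    constants and costs no instruction. *)
Lemma reach_knapsack full (y : J -> fn) k S :
  \sum_(t <- r) lb t <= s <= \sum_(t <- r) ub t ->
  (forall t, t \in r -> avail S (y t)) -> (2 * size r < 2 ^ k)%N ->
  reach full (knapsack_avail y) (40 * (size r * k)) S.
Proof.
move=> sP avy lek; have [r0|rpos] := posnP (size r).
  apply: reach_leq _ (reach_fixed full y (c := lb) S _); first by rewrite r0.
  move: sP; rewrite (size0nil r0) !big_nil => /le_anti <- y'.
  by split; rewrite ?big_nil //; exists 0.
have kpos : (0 < k)%N by case: (k) lek => //; rewrite expn0; lia.
have le1 : (size r <= size r * k)%N by rewrite leq_pmulr.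
move: sP; rewrite le_eqVlt => /andP[/orP[/eqP elb _|ltl]].
  by apply: reach_leq _ (reach_fixed full y S (knapsack_lb^~ elb)); lia.
rewrite le_eqVlt => /orP[/eqP eub|ltu].
  by apply: reach_leq _ (reach_fixed full y S (knapsack_ub^~ (esym eub))); lia.
have sP : \sum_(t <- r) lb t < s < \sum_(t <- r) ub t by rewrite ltl.
pose key i (x : 'rV[R]_d) := breakpoint lb ub (y^~ x) i.
apply: (reach_bind (reach_breakpoints full avy) (n2 := 36 * (size r * k)));
  last by lia.
move=> S1 l1 avk.
apply: (reach_bind (reach_sort full (key := key) (k := k) avk _) (n2 := 34 *
  (size r * k))).
- by rewrite size_breakpoints ltnW.
- move=> S2 l2 [p [pP os]].
  have sp : size p = (2 * size r)%N by rewrite (perm_size pP) size_breakpoints.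
  have [i0 _] : exists i0 : J * bool, true by case: (p) sp => [|i0 p'] /=;
    [lia|exists i0].
  pose B j x := s <= load_sum r lb ub (y^~ x) (key (nth i0 p j) x).
  have l02 := extends_trans l1 l2.
  have test i S' : (0 < i < (2 * size r).-1)%N -> extends S2 S' ->
      reach full (fun S'' => (forall x, dom S'' x -> B i x) \/
         (forall x, dom S'' x -> ~ B i x)) (6 * size r + 2) S'.
    move=> /andP[_ lti] l3.
    have avi : avail S' (key (nth i0 p i)).
      apply: avail_extends (extends_trans l2 l3) (avk _ _).
      by rewrite -(perm_mem pP) mem_nth // sp; lia.
    have avy' t : t \in r -> avail S' (y t).
      by move=> tr; apply: avail_extends (extends_trans l02 l3) (avy t tr).
    apply: (reach_bind (reach_load_sum full avy' avi) (n2 := 2)) =>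
      // S4 l4 avl.
    apply: (reach_bind (reach_const full S4 s) (n2 := 1)) => // S5 l5 avs.
    apply: reach_weaken (reach_cmp full avs (avail_extends l5 avl)) _.
    move=> S6 l6 [H|H]; [left|right] => x Dx; first exact: H.
    by apply/negP; rewrite -ltNge; apply: H.
  have mono x : dom S2 x -> forall i i', (i <= i')%N -> (i' < size p)%N ->
      key (nth i0 p i) x <= key (nth i0 p i') x.
    by move=> Dx i i' lei lti; apply: (kappa_le i0 (os x Dx)).
  have idx x t b : t \in r -> (index (t, b) p < size p)%N /\
      key (nth i0 p (index (t, b) p)) x = breakpoint lb ub (y^~ x) (t, b).
    by move=> tr; apply: (kappa_index lb ub pP i0 (y^~ x)).
  (* The first breakpoint lies below all [false] ones and the last above all [true] ones, which
     settles [B] at both ends. *)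
  apply: (reach_bind (reach_bsearch (B := B) (c := 6 * size r + 2) (k := k)
     (lo := 0) (hi := (2 * size r).-1) test _ _ _ _) (n2 := 8 * size r + 4)).
  + by lia.
  + by lia.
  + move=> x Dx; apply: load_sum_first => // t tr.
    have [lt e] := idx x t false tr; rewrite -[leRHS]e; exact: mono.
  + move=> x Dx; apply/negP; rewrite -ltNge; apply: load_sum_last => // t tr.
    have [lt e] := idx x t true tr; rewrite -[leLHS]e; apply: mono => //; lia.
  + move=> S3 l3 [j [/andP[_ ltj] H]].
    have av3 t : t \in r -> avail S3 (y t).
      by move=> tr; apply: avail_extends (extends_trans l02 l3) (avy t tr).
    apply: reach_weaken (reach_piece full p j av3) _ => S4 l4 avz.
    exists (fun t x => piece_value lb ub p j (y^~ x) (piece_multiplier r lb ub s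
      p j (y^~ x)) t).
    split=> // x Dx; have D3 := l4.2 _ Dx; have [Bj nBj] := H x D3.
    apply: (piece_knapsack lu pP (i0 := i0)) => //.
    * exact: os (l3.2 _ D3).
    * by rewrite sp; lia.
    * by rewrite ltNge; apply/negP.
  + nia.
- by rewrite size_breakpoints; nia.
Qed.

End Program.
End Knapsack.

(** * Isotonic regression *)

Section Isotonic.
Variable R : realType.
Implicit Types (u y : nat -> R).

(* A block of the isotonic regression: constant value [v], the mean of [u], with
   nonnegative partial sums of residuals (KKT multipliers of monotonicity). *)
Definition block u lo hi (v : R) : Prop :=
  [/\ (lo < hi)%N, \sum_(lo <= i < hi) (u i - v) = 0
    & forall j, (lo <= j <= hi)%N -> 0 <= \sum_(lo <= i < j) (u i - v)].

Definition merge_value lo mid hi (v1 v2 : R) : R :=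
  (v1 * (mid - lo)%:R + v2 * (hi - mid)%:R) * ((hi - lo)%:R)^-1.

Lemma sum_shift u (v w : R) lo hi :
  \sum_(lo <= i < hi) (u i - v) = \sum_(lo <= i < hi) (u i - w) + (w - v) * (hi
    - lo)%:R.
Proof.
by rewrite !sumrB !sumr_const_nat mulrBl !mulr_natr addrA subrK.
Qed.

Lemma block1 u n : block u n n.+1 (u n).
Proof.
split=> [//||j]; first by rewrite big_nat1 subrr.
rewrite [(n <= j)%N]leq_eqVlt => /andP[/orP[/eqP <-|lt] le];
  first by rewrite big_geq.
have -> : j = n.+1 by lia.
by rewrite big_nat1 subrr.
Qed.

(** The pooled mean [w] lies between [v2] and [v1]. Up to [mid], lowering [v1] to [w] only increases
    partial sums. Beyond [mid], a partial sum is minus the remaining tail, which stays nonpositive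
    when [v2] is raised to [w]. *)
Lemma block_merge u lo mid hi v1 v2 :
  block u lo mid v1 -> block u mid hi v2 -> v2 <= v1 ->
  block u lo hi (merge_value lo mid hi v1 v2).
Proof.
move=> [lt1 s1 p1] [lt2 s2 p2] le; set w := merge_value _ _ _ _ _.
have lt : (lo < hi)%N by apply: ltn_trans lt2.
have [a0 b0] : 0 < (mid - lo)%:R :> R /\ 0 < (hi - mid)%:R :> R.
  by rewrite !ltr0n; split; lia.
have ab : (hi - lo)%:R = (mid - lo)%:R + (hi - mid)%:R :> R.
  by rewrite -natrD; congr (_%:R); lia.
have wE : w * (hi - lo)%:R = v1 * (mid - lo)%:R + v2 * (hi - mid)%:R.
  by rewrite /w /merge_value divfK // ab gt_eqF // addr_gt0.
have hl0 : 0 < (hi - lo)%:R :> R by rewrite ab addr_gt0.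
have w1 : w <= v1.
  by rewrite -(ler_pM2r hl0) wE ab mulrDr lerD2l ler_wpM2r // ltW.
have w2 : v2 <= w.
  by rewrite -(ler_pM2r hl0) wE ab mulrDr lerD2r ler_wpM2r // ltW.
have sw : \sum_(lo <= i < hi) (u i - w) = 0.
  rewrite (@big_cat_nat _ _ _ mid) ?(ltnW lt1) ?(ltnW lt2) //=.
  rewrite (sum_shift u w v1) s1.
  rewrite (sum_shift u w v2) s2 !add0r.
  move: wE; rewrite ab => wE.
  by rewrite !mulrBl addrACA -wE -opprD -mulrDr subrr.
split=> // j /andP[lej jle]; have [jm|mj] := leqP j mid.
  rewrite (sum_shift u w v1); apply: addr_ge0; first by apply: p1; rewrite lej.
  by apply: mulr_ge0; rewrite ?ler0n ?subr_ge0.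
have pj : 0 <= \sum_(mid <= i < j) (u i - v2) by apply: p2; rewrite ltnW.
have tj : \sum_(j <= i < hi) (u i - v2) <= 0.
  by move: s2; rewrite (@big_cat_nat _ _ _ j) ?(ltnW mj) //=; lra.
suff : \sum_(j <= i < hi) (u i - w) <= 0.
  by move: sw; rewrite (@big_cat_nat _ _ _ j) //=; lra.
rewrite (sum_shift u w v2); have : (v2 - w) * (hi - j)%:R <= 0.
  by apply: mulr_le0_ge0; rewrite ?ler0n ?subr_le0.
lra.
Qed.

(** Abel summation: with nonnegative partial sums and nondecreasing [y], the sum is at most the last
    [y] times the total residual, which is zero. *)
Lemma block_abel u y lo hi v : block u lo hi v ->
  (forall i j, (i <= j < hi)%N -> y i <= y j) ->
  \sum_(lo <= i < hi) (u i - v) * y i <= 0.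
Proof.
move=> [lt s0 p] my.
have H k : (lo + k < hi)%N -> \sum_(lo <= i < (lo + k).+1) (u i - v) * y i <=
    y (lo + k)%N * \sum_(lo <= i < (lo + k).+1) (u i - v).
  elim: k => [|k IH] ltk; first by rewrite addn0 !big_nat1 mulrC.
  rewrite addnS in ltk *; rewrite big_nat_recr ?leqW ?leq_addr //=.
  rewrite [in leRHS]big_nat_recr ?leqW ?leq_addr //=.
  have {}IH := IH (ltnW ltk).
  have q : 0 <= \sum_(lo <= i < (lo + k).+1) (u i - v) by apply: p; lia.
  have yk : y (lo + k)%N <= y (lo + k).+1 by apply: my; lia.
  have := ler_wpM2r q yk; rewrite mulrDr [y _ * (u _ - v)]mulrC; lra.
have [k hk] : exists k, hi = (lo + k).+1 by exists (hi - lo).-1; lia.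
have := H k; rewrite -hk s0 mulr0; apply; lia.
Qed.

(** The reason why clipping after pooling is exact: the sum splits into an Abel part, a multiple of
    the zero total residual, and the variational inequality of [clip] at [v]. *)
Lemma block_variational u y lo hi v (a b : R) : block u lo hi v ->
  (forall i j, (i <= j < hi)%N -> y i <= y j) ->
  (forall i, (i < hi)%N -> a <= y i <= b) ->
  \sum_(lo <= i < hi) (u i - clip a b v) * (y i - clip a b v) <= 0.
Proof.
move=> B my yb; set c := clip a b v; have := block_abel B my;
  case: B => lt s0 _.
have : \sum_(lo <= i < hi) (v - c) * (y i - c) <= 0.
  rewrite big_nat; apply: sumr_le0 => i /andP[_ ilt]; apply: clip_variational;
    exact: yb.
have -> : \sum_(lo <= i < hi) (u i - c) * (y i - c) =
    \sum_(lo <= i < hi) (u i - v) * y i - c * \sum_(lo <= i < hi) (u i - v)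
    + \sum_(lo <= i < hi) (v - c) * (y i - c).
  by rewrite mulr_sumr -sumrB -big_split /=; apply: eq_bigr => i _; ring.
by rewrite s0; lra.
Qed.

(* Blocks are listed from the last one to the first one, each with its start. *)
Fixpoint stack u hi (s : seq (nat * R)) : Prop :=
  match s with
  | [::] => hi = 0%N
  | (lo, v) :: s' => [/\ block u lo hi v,
      if s' is (_, v') :: _ then v' <= v else true & stack u lo s']
  end.

Fixpoint stack_value (s : seq (nat * R)) i : R :=
  if s is (lo, v) :: s' then if (lo <= i)%N then v else stack_value s' i else 0.

Lemma stack_value_le u hi s i : stack u hi s -> (i < hi)%N ->
  if s is (_, v) :: _ then stack_value s i <= v else true.
Proof.
elim: s hi => [//|[lo v] s IH] hi /= [B le st] lti.
case: leqP => // lt; have := IH lo st lt.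
case: s st le {IH} => [/= e|[lo' v'] s _ le le']; first by rewrite e in lt.
exact: le_trans le.
Qed.

Lemma stack_value_mono u hi s i j : stack u hi s -> (i <= j < hi)%N ->
  stack_value s i <= stack_value s j.
Proof.
elim: s hi => [//|[lo v] s IH] hi /= [B le st] /andP[ij jlt].
case: (leqP lo i) => li; case: (leqP lo j) => lj //; first by lia.
  have := stack_value_le st li.
  case: s st le {IH} => [/= e|[lo' v'] s _ le le']; first by rewrite e in li.
  exact: le_trans le.
by apply: IH st _; rewrite ij.
Qed.

Lemma stack_variational u y hi s (a b : R) : stack u hi s ->
  (forall i j, (i <= j < hi)%N -> y i <= y j) ->
  (forall i, (i < hi)%N -> a <= y i <= b) ->
  \sum_(0 <= i < hi) (u i - clip a b (stack_value s i)) *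
                     (y i - clip a b (stack_value s i)) <= 0.
Proof.
elim: s hi => [hi -> _ _|[lo v] s IH hi]; first by rewrite big_nil.
move=> /= [B _ st] my yb; have [lt _ _] := B.
rewrite (@big_cat_nat _ _ _ lo) ?(ltnW lt) //=.
rewrite -[leRHS]addr0; apply: lerD.
  rewrite (eq_big_nat _ _ (F2 := fun i => (u i - clip a b (stack_value s i)) *
                     (y i - clip a b (stack_value s i)))).
    apply: IH st _ _ => [i j /andP[ij jl]|i il].
      by apply: my; rewrite ij (ltn_trans jl).
    by apply: yb; apply: ltn_trans lt.
  by move=> i /andP[_ il]; rewrite leqNgt il.
rewrite (eq_big_nat _ _ (F2 := fun i =>
  (u i - clip a b v) * (y i - clip a b v))).
  exact: block_variational B my yb.
by move=> i /andP[-> _].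
Qed.

(** * Pooling adjacent violators as a computation tree *)

Section Program.
Variable d : nat.
Local Notation fn := ('rV[R]_d -> R).
Implicit Types S : state R d.

Definition stack_at (s : seq (nat * fn)) (x : 'rV[R]_d) : seq (nat * R) :=
  [seq (p.1, p.2 x) | p <- s].

Fixpoint stack_avail (s : seq (nat * fn)) S : Prop :=
  if s is p :: s' then avail S p.2 /\ stack_avail s' S else True.

Lemma stack_avail_extends s S S' : extends S S' -> stack_avail s S ->
  stack_avail s S'.
Proof.
by move=> le; elim: s => //= p s IH [av /IH]; split=> //;
  apply: avail_extends av.
Qed.

(** Block boundaries are known at the node, so the weights and the reciprocal of the total length
    are constants. *)
Lemma reach_merge full lo mid hi (v1 v2 : fn) S : avail S v1 -> avail S v2 ->
  reach full (avail^~ (fun x => merge_value lo mid hi (v1 x) (v2 x))) 7 S.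
Proof.
move=> a1 a2.
apply: (reach_bind (reach_const full S (mid - lo)%:R) (n2 := 6)) => // S1 l1 b1.
have {}a2 := avail_extends l1 a2.
apply: (reach_bind (reach_mul full (avail_extends l1 a1) b1) (n2 := 5)) =>
  // S2 l2 m1.
have {}a2 := avail_extends l2 a2.
apply: (reach_bind (reach_const full S2 (hi - mid)%:R) (n2 := 4)) =>
  // S3 l3 b2.
have {}a2 := avail_extends l3 a2.
apply: (reach_bind (reach_mul full a2 b2) (n2 := 3)) => // S4 l4 m2.
have {}m1 := avail_extends (extends_trans l3 l4) m1.
apply: (reach_bind (reach_add full m1 m2) (n2 := 2)) => // S5 l5 m3.
apply: (reach_bind (reach_const full S5 (hi - lo)%:R^-1) (n2 := 1)) =>
  // S6 l6 b3.
exact: reach_mul (avail_extends l6 m3) b3.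
Qed.

Definition stack_built (u : nat -> fn) hi n S : Prop :=
  exists s, [/\ (size s <= n)%N, stack_avail s S
    & forall x, dom S x -> stack (u^~ x) hi (stack_at s x)].

(** A comparison either stops or triggers one merge of seven instructions, hence 8 per block on the
    stack. *)
Lemma reach_push full (u : nat -> fn) s lo hi v S :
  (forall x, dom S x -> block (u^~ x) lo hi (v x) /\ stack (u^~ x) lo (stack_at
    s x)) ->
  avail S v -> stack_avail s S ->
  reach full (stack_built u hi (size s).+1) (8 * size s) S.
Proof.
elim: s lo v S => [|[lo' v'] s IH] lo v S H av avs.
  by apply: reach_done; exists [:: (lo, v)]; split=> // x /H [].
have [/= av' avs'] := avs.
apply: (reach_bind (reach_cmp full av' av) (n2 := 7 + 8 * size s));
  last by rewrite /=; lia.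
move=> S1 l1 [le|lt].
  apply: reach_done; exists ((lo, v) :: (lo', v') :: s); split=> //.
    split; first exact: avail_extends l1 av.
    exact: stack_avail_extends l1 avs.
  move=> x Dx; have [B st] := H x (l1.2 _ Dx); split=> //.
  exact: le.
apply: (reach_bind (reach_merge full lo' lo hi (avail_extends l1 av')
  (avail_extends l1 av)) (n2 := 8 * size s)) => //.
move=> S2 l2 avm; apply: reach_weaken (IH lo' _ S2 _ avm _) _.
- move=> x Dx; have D1 := l2.2 _ Dx; have [B /= [B' _ st]] := H x (l1.2 _ D1).
  by split=> //; apply: block_merge B' B (ltW (lt x D1)).
- by apply: stack_avail_extends l2 _; apply: stack_avail_extends l1 _.
- by move=> S3 _ [s' [ss sv st]]; exists s'; split=> //; apply: leqW.
Qed.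

(** Merges are counted crudely, without amortization; the quadratic bound is later absorbed by the
    square of [Sbar]. *)
Lemma reach_stack full (u : nat -> fn) n S : (forall i, (i < n)%N -> avail S (u
  i)) ->
  reach full (stack_built u n n) (n * (8 * n)) S.
Proof.
move=> av; suff H k : (k <= n)%N -> reach full (stack_built u k k) (k * (8 * n))
  S.
  exact: H.
elim: k => [_|k IH ltk]; first by apply: reach_done; exists [::]; split.
apply: (reach_bind (IH (ltnW ltk)) (n2 := 8 * n)); last by rewrite mulSn addnC.
move=> S1 l1 [s [ss sv st]].
apply: reach_leq _ (reach_weaken (reach_push full (s := s) (lo := k) (hi :=
  k.+1)
   (v := u k) (u := u) _ _ _) _) => //.
- by rewrite leq_mul2l /= (leq_trans ss) // ltnW.
- by move=> x Dx; split; [apply: block1|apply: st].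
- exact: avail_extends l1 (av k ltk).
- by move=> S2 _ [s' [ss' sv' st']]; exists s'; split=> //;
    apply: leq_trans ss' _.
Qed.

Lemma reach_price_levels full N (a b : R) (w : 'I_N -> fn) S : a <= b ->
  (forall i, avail S (w i)) ->
  reach full (fun S' => exists z : 'I_N -> fn, (forall i, avail S' (z i)) /\
    forall x, dom S' x ->
      variational (price_levels a b) (\row_i w i x) (\row_i z i x)) (8 * (N * N)
        + 4 * N) S.
Proof.
move=> ab av; pose u i : fn := if insub i is Some j then w j else fun=> 0.
have uE (j : 'I_N) : u j = w j by rewrite /u valK.
have avu i : (i < N)%N -> avail S (u i).
  by move=> lt; rewrite -[i]/(val (Ordinal lt)) uE.
apply: (reach_bind (reach_stack full avu) (n2 := N * 4)); last by lia.
move=> S1 l1 [s [_ sv st]]; pose z (i : 'I_N) x := clip a b (stack_value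
  (stack_at s x) i).
have avz (i : 'I_N) : avail S1 (fun x => stack_value (stack_at s x) i).
  elim: s sv {st z} => [_|[lo v] s IH /= [avv avs]]; first exact: avail0.
  by case: leqP => _; [|apply: IH].
rewrite -[X in reach _ _ (X * 4)](card_ord N).
apply: reach_weaken (@reach_forall _ _ full _ (fun i S =>
  avail S (z i)) 4 S1 _ _) _.
- by move=> i; apply: persistent_avail.
- by move=> i S2 l2; apply: reach_clip => //; apply: avail_extends l2 (avz i).
move=> S2 l2 az; exists z; split=> // x Dx.
have stx := st x (l2.2 _ Dx); split.
  split=> [i|i j ij]; rewrite !mxE; first exact: clip_itv.
  by apply: clip_le => //; apply: stack_value_mono stx _; rewrite ij ltn_ord.
move=> y [yb ym]; pose y' i : R := if insub i is Some j then y 0 (j : 'I_N) else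
  0.
have y'E (j : 'I_N) : y' j = y 0 j by rewrite /y' valK.
have := @stack_variational (u^~ x) y' N (stack_at s x) a b stx _ _.
rewrite big_mkord; under eq_bigr do rewrite uE y'E.
under [in X in _ -> X]eq_bigr do rewrite !mxE.
apply=> [i j /andP[ij lt]|i lt].
  by rewrite -[i]/(val (Ordinal (leq_ltn_trans ij lt))) -[j]/(val (Ordinal lt))
    !y'E; apply: ym.
by rewrite -[i]/(val (Ordinal lt)) y'E; apply: yb.
Qed.

End Program.
End Isotonic.

(** * Prices and client values *)

Section Model.
Variable R : realType.

Lemma lebesgue_measure_overlap (t a b : R) : a <= b ->
  lebesgue_measure (`]t, t + 1] `&` `]a, b]) =
  (clip t (t + 1) b - clip t (t + 1) a)%:E.
Proof.
move=> ab.
have -> : `]t, t + 1] `&` `]a, b] = `]clip t (t + 1) a, clip t (t + 1)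
  b]%classic.
  apply/seteqP; split=> x; rewrite /= !in_itv /= !clipE; try lra.
    move=> [/andP[h1 h2] /andP[h3 h4]]; apply/andP; split.
      by case: (leP a t) => ?; [|case: (leP (t + 1) a) => ?]; lra.
    by case: (leP b t) => ?; [|case: (leP (t + 1) b) => ?]; lra.
  move=> /andP[]; case: (leP a t) => ?; [|case: (leP (t + 1) a) => ?];
    (case: (leP b t) => ?; [|case: (leP (t + 1) b) => ?]) => ? ?;
    split; apply/andP; split; lra.
rewrite lebesgue_measure_itv /= lte_fin; case: ltP => // le.
have le' : clip t (t + 1) a <= clip t (t + 1) b by apply: clip_le => //; lra.
by rewrite (_ : clip t (t + 1) b = clip t (t + 1) a) ?subrr //;
  apply/le_anti/andP.
Qed.

(** The window and its shift by [T] are disjoint because the length is at most [T], and the unit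
    interval already lies inside the horizon. *)
Lemma subperiod_measure (T t m : nat) (s0 : R) (l : 'rV[R]_m) (s : 'I_m) :
  (t < T)%N -> 0 <= l 0 s <= T%:R ->
  let a := subperiod_start s0 l s in let b := a + l 0 s in
  let c := clip t%:R (t%:R + 1) in
  fine (lebesgue_measure (`]t%:R, t.+1%:R] `&` subperiod T s0 l s)) =
  c b - c a + (c (b - T%:R) - c (a - T%:R)).
Proof.
move=> ltT /andP[l0 lT] a b c.
have tT : t%:R + 1 <= T%:R :> R by rewrite natr1 ler_nat.
have t0 : 0 <= t%:R :> R by [].
rewrite /subperiod -/a -/b -natr1.
have -> : `]t%:R, t%:R + 1] `&` ((`]a, b] `|` `]a - T%:R, b - T%:R]) `&` `]0,
  T%:R]) =
    (`]t%:R, t%:R + 1] `&` `]a, b]) `|` (`]t%:R, t%:R + 1] `&` `]a - T%:R, b -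
      T%:R])
    :> set R.
  rewrite -setIUr setIA setIC setIA; apply/seteqP; split=> x;
    first by move=> [[]].
  move=> [h1 h2]; split=> //; split=> //; move: h1;
    rewrite /= !in_itv /= => /andP[h3 h4].
  by apply/andP; split; lra.
rewrite measureU /=; last first.
- apply/seteqP; split=> // x; rewrite /= !in_itv /=.
  by move=> [[_ /andP[h1 h2]] [_ /andP[h3 h4]]]; rewrite /b in h2 h4; lra.
- by apply: measurableI; apply: measurable_itv.
- by apply: measurableI; apply: measurable_itv.
by rewrite !lebesgue_measure_overlap //; rewrite /b; lra.
Qed.

Definition price_formula (T N m : nat) (omega : 'I_m -> 'I_N)
    (q : 'rV[R]_N) (s0 : R) (l : 'rV[R]_m) (t : 'I_T) : R :=
  \sum_s q 0 (omega s) *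
    (let a := subperiod_start s0 l s in let b := a + l 0 s in
     let c := clip t%:R (t%:R + 1) in
     c b - c a + (c (b - T%:R) - c (a - T%:R))).

Lemma price_map_formula (T N m : nat) (omega : 'I_m -> 'I_N)
    (q : 'rV[R]_N) (s0 : R) (l : 'rV[R]_m) :
  (forall s, 0 <= l 0 s <= T%:R) ->
  price_map T omega q s0 l = \row_t price_formula omega q s0 l t.
Proof.
move=> lP; apply/rowP => t; rewrite !mxE; apply: eq_bigr => s _.
by rewrite subperiod_measure.
Qed.

Lemma lengths_le (T N m : nat) (L_ : 'I_N -> nat) (omega : 'I_m -> 'I_N)
    (l : 'rV[R]_m) :
  (\sum_n L_ n)%N = T -> lengths L_ omega l ->
  forall s, 0 <= l 0 s <= T%:R.
Proof.
move=> sL [l1 sl] s; have l0 s' : 0 <= l 0 s' by apply: le_trans (l1 s').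
rewrite l0 /=; apply: (@le_trans _ _ (L_ (omega s))%:R).
  by rewrite -sl (bigD1 s) //= lerDl; apply: sumr_ge0.
by rewrite ler_nat -sL (bigD1 (omega s)) //= leq_addr.
Qed.

Definition value_at (T : nat) (k : client R T) (p x : 'rV[R]_T) : R :=
  bill p x + (2 * cl_alpha k)^-1 * \sum_t (x 0 t - cl_x0 k 0 t) ^+ 2.

(** Completing the square: up to a positive factor, the excess of [y] over [x] is their squared
    distance minus twice the inner product that the variational inequality makes nonpositive. *)
Lemma client_value_variational (T : nat) (k : client R T) (p x : 'rV[R]_T) : 0 <
  cl_alpha k ->
  variational (loads k) (cl_x0 k - cl_alpha k *: p) x ->
  client_value k p = value_at k p x.
Proof.
move=> a0 [lx vx]; rewrite /client_value; set E := (X in inf X).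
have sqE (y : 'rV[R]_T) : bill p y + (2 * cl_alpha k)^-1 * norm2 (y - cl_x0 k)
  ^+ 2 = value_at k p y.
  rewrite /norm2 sqr_sqrtr; last by apply: sumr_ge0 => i _; apply: sqr_ge0.
  by congr (_ + _ * _); apply: eq_bigr => i _; rewrite !mxE.
have lb : lbound E (value_at k p x).
  move=> _ [y ly <-]; rewrite sqE -subr_ge0.
  have -> : value_at k p y - value_at k p x = (2 * cl_alpha k)^-1 *
     (\sum_t (y 0 t - x 0 t) ^+ 2 -
      2 * \sum_t ((cl_x0 k - cl_alpha k *: p) 0 t - x 0 t) * (y 0 t - x 0 t)).
    rewrite /value_at /bill mulr_sumr -sumrB !mulr_sumr -!big_split -sumrB /=.
    apply: eq_bigr => t _; rewrite !mxE; field; lra.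
  apply: mulr_ge0; first by rewrite invr_ge0; lra.
  have : 0 <= \sum_t (y 0 t - x 0 t) ^+ 2 by apply: sumr_ge0 => i _;
    apply: sqr_ge0.
  by have := vx y ly; lra.
have Ex : E (value_at k p x) by exists x; rewrite ?sqE.
apply/le_anti/andP; split; first by apply: ge_inf => //;
  exists (value_at k p x).
by apply: lb_le_inf => //; exists (value_at k p x).
Qed.

End Model.

(** * Programs for the pricing model *)

Section Routines.
Variables (R : realType) (d : nat).
Local Notation fn := ('rV[R]_d -> R).
Implicit Types (S : state R d).

Definition computed_proj n (A : set 'rV[R]_n) (w : 'I_n -> fn) S : Prop :=
  exists z : 'I_n -> fn, (forall i, avail S (z i)) /\
    forall x, dom S x -> variational A (\row_i w i x) (\row_i z i x).

Lemma knapsack_avail_extends (J : eqType) (r : seq J) lb ub s (y : J -> fn) :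
  persistent (knapsack_avail r lb ub s y).
Proof.
move=> S S' le [z [av H]]; exists z; split=> [t tr|x Dx]; last exact/H/le.2.
exact: avail_extends le (av t tr).
Qed.

(** The constraints couple only subperiods with the same level, so the projection splits into one
    box-and-hyperplane problem per [n]. At most [L_ n] subperiods share the total [L_ n], which
    makes the lower bounds 1 feasible. *)
Lemma reach_lengths full N m (L_ : 'I_N -> nat) (omega : 'I_m -> 'I_N)
    (w : 'I_m -> fn) k S :
  (forall n, (1 <= #|[set s | omega s == n]%SET| <= L_ n)%N) ->
  (forall s, avail S (w s)) -> (2 * m < 2 ^ k)%N ->
  reach full (computed_proj (lengths L_ omega) w) (N * (40 * (m * k))) S.
Proof.
move=> mn av lek; pose r n := [seq s <- enum 'I_m | omega s == n].
have inr s n : (s \in r n) = (omega s == n) by rewrite mem_filter mem_enum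
  andbT.
have sr n : size (r n) = #|[set s | omega s == n]%SET|.
  rewrite cardE /r; apply: perm_size; apply: uniq_perm.
  - by rewrite filter_uniq // enum_uniq.
  - exact: enum_uniq.
  - by move=> s; rewrite inr mem_enum inE.
have srm n : (size (r n) <= m)%N by rewrite sr; apply: leq_trans (max_card _) _;
  rewrite card_ord.
have rsum n (F : 'I_m -> R) : \sum_(s <- r n) F s = \sum_(s | omega s == n) F s.
  by rewrite /r big_filter big_enum_cond.
have const n (c : R) : \sum_(s <- r n) c = c * (size (r n))%:R.
  by rewrite big_const_seq count_predT iter_addr_0 mulr_natr.
(* Lengths have no upper bound in the model: [L_ n + 1] is never attained. *)
pose Q n := knapsack_avail (r n) (fun=> 1) (fun=> (L_ n)%:R + 1) (L_ n)%:R w.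
have lu n : 1 <= (L_ n)%:R + 1 :> R by rewrite lerDr.
have step n S' : extends S S' -> reach full (Q n) (40 * (m * k)) S'.
  move=> le; apply: (@reach_leq _ _ _ _ (40 * (size (r n) * k))).
    by rewrite leq_mul2l /= leq_mul2r srm orbT.
  apply: reach_knapsack => //.
  - have /andP[m1 m2] := mn n; rewrite !const sr mul1r ler_nat m2 /=.
    have : (1 : R) <= #|[set s | omega s == n]%SET|%:R by rewrite (ler_nat _ 1).
    by have : 0 <= (L_ n)%:R :> R by []; nra.
  - by move=> s _; apply: avail_extends le (av s).
  - by apply: leq_ltn_trans lek; rewrite leq_mul2l srm orbT.
rewrite -[X in reach _ _ (X * _)](card_ord N).
apply: reach_weaken (reach_forall _ step) _.
  by move=> n; apply: knapsack_avail_extends.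
move=> S' le /choice [z Hz]; exists (fun s => z (omega s) s).
split=> [s|x Dx]; first by apply: (Hz _).1; rewrite inr.
have K n := (Hz n).2 x Dx.
have zb s : 1 <= z (omega s) s x <= (L_ (omega s))%:R + 1.
  by apply: (knapsack_itv _ (K (omega s))); rewrite ?inr.
have zsum n : \sum_(s | omega s == n) z (omega s) s x = (L_ n)%:R.
  rewrite -rsum; have [<- _] := K n; rewrite !rsum.
  by apply: eq_bigr => s /eqP ->.
split.
  split=> [s|n]; first by rewrite mxE; have /andP[] := zb s.
  by rewrite -zsum; apply: eq_bigr => s _; rewrite mxE.
move=> y [y1 ysum]; rewrite (partition_big omega xpredT) //=.
apply: sumr_le0 => n _; rewrite -rsum.
rewrite (eq_big_seq (fun s => (w s x - z n s x) * (y 0 s - z n s x)));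
  last first.
  by move=> s; rewrite inr !mxE => /eqP ->.
apply: (knapsack_variational (K n)); last by rewrite rsum ysum.
move=> s; rewrite inr => sn; rewrite y1 /=.
have : y 0 s <= (L_ n)%:R.
  rewrite -ysum (bigD1 s) //= lerDl; apply: sumr_ge0 => s' _.
  exact: le_trans (y1 s').
by lra.
Qed.

Lemma reach_loads full T (c : client R T) (w : 'I_T -> fn) k S :
  admissible_client c -> (forall t, avail S (w t)) -> (2 * T < 2 ^ k)%N ->
  reach full (computed_proj (loads c) w) (40 * (T * k)) S.
Proof.
move=> [_ bnd /andP[/ltW lo /ltW hi] _] av lek.
have sE (F : 'I_T -> R) : \sum_(t <- enum 'I_T) F t = \sum_t F t by rewrite
  big_enum.
have lu t : t \in enum 'I_T -> cl_xlb c 0 t <= cl_xub c 0 t.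
  by move=> _; have [_ h1 h2] := bnd t; apply: le_trans h2.
have := @reach_knapsack R d _ (enum 'I_T) _ _ (\sum_t cl_x0 c 0 t) lu full w k
  S.
rewrite size_enum_ord !sE lo hi => /(_ isT (fun t _ => av t) lek) H.
apply: reach_weaken H _ => S' le [z [avz K]].
exists z; split=> [t|x Dx]; first by apply: avz; rewrite mem_enum.
have {}K := K x Dx; split.
  split; first by rewrite -K.1 sE; apply: eq_bigr => t _; rewrite mxE.
  by move=> t; rewrite mxE; apply: (knapsack_itv lu K); rewrite mem_enum.
move=> y [ys yb]; have := knapsack_variational K (w := fun t => y 0 t).
rewrite !sE ys => /(_ (fun t _ => yb t) erefl).
by congr (_ <= _); apply: eq_bigr => t _; rewrite !mxE.
Qed.

(** Each start is summed afresh, which is quadratic in [m]. Each period then takes 20 instructions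
    per subperiod for its term and one to add it. *)
Lemma reach_prices full T N m (omega : 'I_m -> 'I_N)
    (q : 'I_N -> fn) (s0 : fn) (l : 'I_m -> fn) S :
  (forall n, avail S (q n)) -> avail S s0 -> (forall s, avail S (l s)) ->
  reach full (fun S' => forall t : 'I_T, avail S' (fun x =>
     price_formula omega (\row_n q n x) (s0 x) (\row_s l s x) t))
    (m * (m + 5) + T * (21 * m)) S.
Proof.
move=> avq avs avl.
pose a s x := subperiod_start (s0 x) (\row_s l s x) s.
pose Q s S := [/\ avail S (a s), avail S (fun x => a s x + l s x),
   avail S (fun x => a s x - T%:R) & avail S (fun x => a s x + l s x - T%:R)].
have persQ s : persistent (Q s).
  by move=> S1 S2 le [h1 h2 h3 h4]; split; apply: avail_extends le _.
have stepQ s S1 : extends S S1 -> reach full (Q s) (m + 5) S1.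
  move=> l1; pose r := [seq i : 'I_m <- enum 'I_m | (i < s)%N].
  have sr : (size r <= m)%N by rewrite size_filter -[leqRHS]size_enum_ord
    count_size.
  apply: (@reach_leq _ _ _ _ (size r + 5)); first by rewrite leq_add2r.
  apply: (reach_bind (reach_sum full (r := r) (g := l) _) (n2 := 5)) => //.
    by move=> i _; apply: avail_extends l1 (avl i).
  move=> S2 l2 av2; have l02 := extends_trans l1 l2.
  apply: (reach_bind (reach_add full (avail_extends l02 avs) av2) (n2 := 4)) =>
    // S3 l3 av3.
  have ava : avail S3 (a s).
    apply: avail_eq av3 _ => x _; rewrite /a /subperiod_start; congr (_ + _).
    by rewrite /r big_filter big_enum_cond; apply: eq_bigr => i _; rewrite mxE.
  have l03 := extends_trans l02 l3.
  apply: (reach_bind (reach_add full ava (avail_extends l03 (avl s))) (n2 := 3))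
    => // S4 l4 avb.
  apply: (reach_bind (reach_const full S4 T%:R) (n2 := 2)) => // S5 l5 avT.
  have {}ava := avail_extends (extends_trans l4 l5) ava.
  have {}avb := avail_extends l5 avb.
  apply: (reach_bind (reach_sub full ava avT) (n2 := 1)) => // S6 l6 avaT.
  apply: reach_weaken (reach_sub full (avail_extends l6 avb) (avail_extends l6
    avT)) _.
  move=> S7 l7 avbT; have l57 := extends_trans l6 l7.
  by split=> //; [apply: avail_extends ava|apply: avail_extends avb|apply:
    avail_extends avaT].
have := @reach_forall _ _ full _ Q (m + 5) S persQ stepQ; rewrite card_ord => H.
apply: (reach_bind H (n2 := T * (21 * m))) => // S1 l1 avQ.
have avq1 n := avail_extends l1 (avq n).
rewrite -[X in reach _ _ (X * _)](card_ord T).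
apply: reach_forall => [t|t S2 l2]; first exact: persistent_avail.
pose cl := clip (t%:R : R) (t%:R + 1).
have ct : t%:R <= t%:R + 1 :> R by rewrite lerDl.
pose g s x := q (omega s) x * (cl (a s x + l s x) - cl (a s x) +
   (cl (a s x + l s x - T%:R) - cl (a s x - T%:R))).
have stepg s S3 : extends S2 S3 -> reach full (avail^~ (g s)) 20 S3.
  move=> l3; have l13 := extends_trans l2 l3.
  have [h1 h2 h3 h4] := persQ s _ _ l13 (avQ s).
  apply: (reach_bind (reach_clip full ct h2) (n2 := 16)) => // S4 l4 c2.
  apply: (reach_bind (reach_clip full ct (avail_extends l4 h1)) (n2 := 12)) =>
    // S5 l5 c1.
  apply: (reach_bind (reach_sub full (avail_extends l5 c2) c1) (n2 := 11)) =>
    // S6 l6 d1.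
  have l36 := extends_trans l4 (extends_trans l5 l6).
  apply: (reach_bind (reach_clip full ct (avail_extends l36 h4)) (n2 := 7)) =>
    // S7 l7 c4.
  have l37 := extends_trans l36 l7.
  apply: (reach_bind (reach_clip full ct (avail_extends l37 h3)) (n2 := 3)) =>
    // S8 l8 c3.
  apply: (reach_bind (reach_sub full (avail_extends l8 c4) c3) (n2 := 2)) =>
    // S9 l9 d2.
  have l69 := extends_trans l7 (extends_trans l8 l9).
  apply: (reach_bind (reach_add full (avail_extends l69 d1) d2) (n2 := 1)) =>
    // S10 l10 e.
  apply: reach_mul e; apply: avail_extends (avq1 (omega s)).
  exact: extends_trans l13 (extends_trans (extends_trans l36 l69) l10).
have := @reach_forall _ _ full _ (fun s => avail^~ (g s)) 20 S2
  (fun s => @persistent_avail _ _ (g s)) stepg; rewrite card_ord => Hg.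
apply: (reach_bind Hg (n2 := m)) => [S3 l3 avg|]; last by lia.
apply: reach_weaken (reach_sum_ord full avg) _ => S4 l4 avsum.
apply: avail_eq avsum _ => x _; rewrite /price_formula; apply: eq_bigr => s _.
by rewrite !mxE.
Qed.

Lemma reach_client full T (C : 'rV[R]_T -> R) (c : client R T) (p : 'I_T -> fn)
  k S :
  admissible_client c -> (forall t, avail S (p t)) -> (2 * T < 2 ^ k)%N ->
  reach full (cost_leaf C (fun x => client_profit C c (\row_t p t x)))
    (40 * (T * k) + 10 * T + 20) S.
Proof.
move=> adm avp lek; have [[_ a0 _] _ _ _] := adm.
pose w t x := cl_x0 c 0 t - cl_alpha c * p t x.
have stepw t S' : extends S S' -> reach full (avail^~ (w t)) 4 S'.
  move=> l1; apply: (reach_bind (reach_const full S' (cl_alpha c)) (n2 := 3)) =>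
    // S1 l2 av1.
  have avpt := avail_extends (extends_trans l1 l2) (avp t).
  apply: (reach_bind (reach_mul full av1 avpt) (n2 := 2)) => // S2 _ av2.
  apply: (reach_bind (reach_const full S2 (cl_x0 c 0 t)) (n2 := 1)) =>
    // S3 l3 av3.
  exact: reach_sub (avail_extends l3 av2).
have := @reach_forall _ _ full _ (fun t => avail^~ (w t)) 4 S
  (fun t => @persistent_avail _ _ (w t)) stepw; rewrite card_ord => Hw.
apply: (reach_bind Hw (n2 := 40 * (T * k) + 6 * T + 20)); last by lia.
move=> S1 l1 avw.
apply: (reach_bind (reach_loads full adm avw lek) (n2 := 6 * T + 20));
  last by lia.
move=> S2 l2 [z [avz vz]].
have avp2 t := avail_extends (extends_trans l1 l2) (avp t).
pose b t x := p t x * z t x.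
have stepb t S' : extends S2 S' -> reach full (avail^~ (b t)) 1 S'.
  by move=> le; apply: reach_mul; apply: avail_extends le _.
have := @reach_forall _ _ full _ (fun t => avail^~ (b t)) 1 S2
  (fun t => @persistent_avail _ _ (b t)) stepb; rewrite card_ord => Hb.
apply: (reach_bind Hb (n2 := 5 * T + 20)); last by lia.
move=> S3 l3 avb.
apply: (reach_bind (reach_sum_ord full avb) (n2 := 4 * T + 20)); last by lia.
move=> S4 l4 avbill.
have l24 := extends_trans l3 l4.
pose e t x := (z t x - cl_x0 c 0 t) * (z t x - cl_x0 c 0 t).
have stepe t S' : extends S4 S' -> reach full (avail^~ (e t)) 3 S'.
  move=> l5; have avzt := avail_extends (extends_trans l24 l5) (avz t).
  apply: (reach_bind (reach_const full S' (cl_x0 c 0 t)) (n2 := 2)) =>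
    // S5 l6 av5.
  apply: (reach_bind (reach_sub full (avail_extends l6 avzt) av5) (n2 := 1)) =>
    // S6 _ av6.
  exact: reach_mul.
have := @reach_forall _ _ full _ (fun t => avail^~ (e t)) 3 S4
  (fun t => @persistent_avail _ _ (e t)) stepe; rewrite card_ord => He.
apply: (reach_bind He (n2 := T + 20)); last by lia.
move=> S5 l5 ave.
apply: (reach_bind (reach_sum_ord full ave) (n2 := 20)); last by lia.
move=> S6 l6 avq.
have l46 := extends_trans l5 l6; have {}avbill := avail_extends l46 avbill.
apply: (reach_bind (reach_const full S6 (2 * cl_alpha c)^-1) (n2 := 19)) =>
  // S7 l7 h7.
apply: (reach_bind (reach_mul full h7 (avail_extends l7 avq)) (n2 := 18)) =>
  // S8 l8 h8.
have l68 := extends_trans l7 l8; have {}avbill := avail_extends l68 avbill.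
apply: (reach_bind (reach_add full avbill h8) (n2 := 17)) => // S9 l9 h9.
(* The reference value does not depend on the decision, so it enters as a constant. *)
apply: (reach_bind (reach_const full S9 (client_value c (cl_p0 c))) (n2 := 16))
  => // S10 l10 h10.
apply: (reach_bind (reach_sub full h10 (avail_extends l10 h9)) (n2 := 15)) =>
  // S11 l11 h11.
apply: (reach_bind (reach_const full S11 (cl_beta c)) (n2 := 14)) =>
  // S12 l12 h12.
apply: (reach_bind (reach_mul full h12 (avail_extends l12 h11)) (n2 := 13)) =>
  // S13 l13 h13.
apply: (reach_bind (reach_clip full ler01 h13) (n2 := 9)) => // S14 l14 h14.
apply: (reach_bind (reach_const full S14 (cl_w c)) (n2 := 8)) => // S15 l15 h15.
apply: (reach_bind (reach_mul full h15 (avail_extends l15 h14)) (n2 := 7)) =>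
  // S16 l16 h16.
have l8' : extends S8 S16.
  do 7 (apply: extends_trans; last eassumption); exact: l9.
apply: (reach_bind (reach_mul full (avail_extends l8' avbill) h16) (n2 := 6)) =>
  // S17 l17 h17.
have l2' : extends S2 S17.
  apply: extends_trans l17; apply: extends_trans l8'.
  exact: extends_trans l24 (extends_trans l46 l68).
(* With [b] the weight times the uptake and [a] the bill times [b], the profit is [a] minus [b]
   times the cost of the load; [C] itself is not evaluated here. *)
apply: reach_done; eexists _, _, z; split;
  [exact: h17|exact: avail_extends h16| |].
  by move=> t; apply: avail_extends l2' (avz t).
move=> x Dx /=; have {}vz := vz x (l2'.2 _ Dx).
have wE : \row_t w t x = cl_x0 c - cl_alpha c *: \row_t p t x.
  by apply/rowP => t; rewrite !mxE.
rewrite wE in vz.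
have billE : bill (\row_t p t x) (\row_t z t x) = \sum_t b t x.
  by apply: eq_bigr => t _; rewrite !mxE.
have valE : client_value c (\row_t p t x) =
    \sum_t b t x + (2 * cl_alpha c)^-1 * \sum_t e t x.
  rewrite (client_value_variational a0 vz) /value_at billE; congr (_ + _ * _).
  by apply: eq_bigr => t _; rewrite !mxE expr2.
rewrite /client_profit /client_uptake /client_load (proj_variational vz) billE.
by rewrite projR_itv ?ler01 // valE; ring.
Qed.

End Routines.

(** * The reformulated problem *)

Section Existence.
Variable R : realType.

Lemma avail_input d (i : 'I_d) : avail (input_state R d) (fun x => x 0 i).
Proof. by exists i => x _; rewrite /= cell_fun_input. Qed.

(* A program computing the projection of every input shows that it exists. *)
Lemma reach_variational n (A : set 'rV[R]_n) c (u : 'rV[R]_n) :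
  reach false (computed_proj A (fun i x => x 0 i)) c (input_state R n) ->
  exists x, variational A u x.
Proof.
move=> r; have [S' [_ [z [_ H]] Du]] := reach_sound (x := u) r I.
have uE : \row_i u 0 i = u by apply/rowP => i; rewrite mxE.
by exists (\row_i z i u); have := H u Du; rewrite /= uE.
Qed.

Lemma price_levels_variational N (a b : R) (u : 'rV[R]_N) : a <= b ->
  exists x, variational (price_levels a b) u x.
Proof.
by move=> ab; apply: reach_variational (reach_price_levels false ab
  (@avail_input N)).
Qed.

Lemma lengths_variational N m (L_ : 'I_N -> nat) (omega : 'I_m -> 'I_N) (u :
  'rV[R]_m) :
  (forall n, (1 <= #|[set s | omega s == n]%SET| <= L_ n)%N) ->
  exists x, variational (lengths L_ omega) u x.
Proof.
move=> mn; apply: reach_variational (reach_lengths false mn (@avail_input m) _).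
exact: ltn_expl.
Qed.

Lemma loads_variational T (c : client R T) (u : 'rV[R]_T) : admissible_client c
  ->
  exists x, variational (loads c) u x.
Proof.
move=> adm; apply: reach_variational (reach_loads false adm (@avail_input T) _).
exact: ltn_expl.
Qed.

End Existence.

(** * The equivalence, and one client's term as a tree and as a continuous function *)

Section Problem.
Variables (R : realType) (T N m : nat) (plb pub : R) (L_ : 'I_N -> nat).
Variables (omega : 'I_m -> 'I_N) (Lam : R).
Hypotheses (lePub : plb <= pub) (sumL : (\sum_n L_ n)%N = T).
Hypothesis blocksL : forall n, (1 <= #|[set s | omega s == n]%SET| <= L_ n)%N.
Hypothesis boxL : forall z, feasible T plb pub L_ omega z -> box Lam (pack z).
Local Notation h := (retract T plb pub L_ omega Lam).
Local Notation d := (N + 1 + m)%N.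

Lemma feasible_proj (q : 'rV[R]_N) (s0 : R) (l : 'rV[R]_m) :
  feasible T plb pub L_ omega (Defs.proj (price_levels plb pub) q,
    projR `[0, T%:R] s0, Defs.proj (lengths L_ omega) l).
Proof.
have [x vx] := price_levels_variational q lePub.
have [y vy] := lengths_variational l blocksL.
rewrite (proj_variational vx) (proj_variational vy) projR_itv ?ler0n //.
split=> /=; [by case: vx|by rewrite clip_itv|by case: vy].
Qed.

(** A feasible point exists, and its start coordinate lies between [- Lam] and [Lam]. *)
Lemma Lam_ge0 : 0 <= Lam.
Proof.
have := boxL (feasible_proj 0 0 0) (lshift m (rshift N ord0)).
by move=> /andP[]; lra.
Qed.

Lemma feasible_retract u : feasible T plb pub L_ omega (h u).
Proof. exact: feasible_proj. Qed.

Lemma pack_retract z : feasible T plb pub L_ omega z -> h (pack z) = z.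
Proof.
move=> fz; rewrite /retract (proj_id (boxL fz)) /unpack /pack.
case: z fz => -[q s0] l [/= fq fs fl].
rewrite !row_mxKl !row_mxKr mxE (proj_id fq) (proj_id fl) projR_itv ?ler0n //.
rewrite clipE ?ler0n //; have /andP[s0ge s0le] := fs.
by congr (_, _, _); case: leP => ?; [|case: leP => ?]; lra.
Qed.

Lemma equivalent_retract (f : decision R N m -> R) :
  equivalent_unconstrained (f \o h) (feasible T plb pub L_ omega) f h.
Proof.
split.
  congr ereal_sup; apply/seteqP; split=> _ [z zP <-].
    by exists (h z) => //; apply: feasible_retract.
  by exists (pack z) => //=; rewrite (pack_retract zP).
apply/seteqP; split=> [_ [u [_ umax] <-]|z [fz zmax]].
  split; first exact: feasible_retract.
  by move=> y fy; have := umax (pack y) I; rewrite /= (pack_retract fy).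
exists (pack z); last exact: pack_retract.
split=> [|u _]; first exact: I.
by rewrite /= (pack_retract fz); apply/zmax/feasible_retract.
Qed.

Let hat j (u : 'rV[R]_d) : R := clip (- Lam) Lam (u 0 j).
Let hat_q (n : 'I_N) := hat (lshift m (lshift 1 n)).
Let hat_s := hat (lshift m (rshift N ord0)).
Let hat_l (s : 'I_m) := hat (rshift (N + 1) s).

Lemma retractE u : h u = (Defs.proj (price_levels plb pub) (\row_n hat_q n u),
  clip 0 T%:R (hat_s u), Defs.proj (lengths L_ omega) (\row_s hat_l s u)).
Proof.
rewrite /retract proj_box ?Lam_ge0 // /unpack /= !mxE projR_itv ?ler0n //.
by congr (Defs.proj _ _, _, Defs.proj _ _); apply/rowP => i; rewrite !mxE.
Qed.

Lemma prices_retract u : prices T omega (h u) =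
  \row_t price_formula omega (h u).1.1 (h u).1.2 (h u).2 t.
Proof.
have [_ _ hl] := feasible_retract u.
by apply: price_map_formula; apply: lengths_le sumL hl.
Qed.

Definition computed_retract S : Prop :=
  exists (q : 'I_N -> 'rV[R]_d -> R) (s0 : 'rV[R]_d -> R) (l : 'I_m -> 'rV[R]_d
    -> R),
  [/\ forall n, avail S (q n), avail S s0, forall s, avail S (l s)
    & forall x, dom S x -> h x = (\row_n q n x, s0 x, \row_s l s x)].

Lemma reach_retract full k : (2 * m < 2 ^ k)%N ->
  reach full computed_retract
    (4 * d + (8 * (N * N) + 4 * N) + 4 + N * (40 * (m * k))) (input_state R d).
Proof.
move=> lek; have L0 : - Lam <= Lam by have := Lam_ge0; lra.
have stephat j S : extends (input_state R d) S -> reach full (avail^~ (hat j)) 4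
  S.
  by move=> le; apply: reach_clip L0 _;
    apply: avail_extends le (avail_input R j).
have := @reach_forall _ _ full _ (fun j => avail^~ (hat j)) 4 (input_state R d)
  (fun j => @persistent_avail _ _ (hat j)) stephat; rewrite card_ord => H.
apply: (reach_bind H (n2 := 8 * (N * N) + 4 * N + 4 + N * (40 * (m * k))));
  last by lia.
move=> S1 l1 avh.
have avq n : avail S1 (hat_q n) by apply: avh.
apply: (reach_bind (reach_price_levels full lePub avq) (n2 := 4 + N * (40 * (m *
  k)))); last by lia.
move=> S2 l2 [q [av2 vq]].
have avs : avail S2 hat_s by apply: avail_extends l2 (avh _).
apply: (reach_bind (reach_clip full (ler0n R T) avs) (n2 := N * (40 * (m * k))))
  => //.
move=> S3 l3 av3; have l13 := extends_trans l2 l3.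
have avl s : avail S3 (hat_l s) by apply: avail_extends l13 (avh _).
apply: reach_weaken (reach_lengths full blocksL avl lek) _ =>
  S4 l4 [l [av4 vl]].
have l24 := extends_trans l3 l4.
exists q, (fun x => clip 0 T%:R (hat_s x)), l; split=> [n|| |x Dx].
- exact: avail_extends l24 (av2 n).
- exact: avail_extends l4 av3.
- exact: av4.
- rewrite retractE (proj_variational (vl x Dx)).
  by rewrite (proj_variational (vq x (l24.2 _ Dx))).
Qed.

Variables (C : 'rV[R]_T -> R) (c : client R T).
Hypothesis adm : admissible_client c.
Local Notation term := (fun u => client_profit C c (prices T omega (h u))).

Lemma reach_term k : (2 * T < 2 ^ k)%N -> (m <= T)%N ->
  reach false (cost_leaf C term)
    (4 * d + (8 * (N * N) + 4 * N) + 4 + N * (40 * (m * k)) +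
     (m * (m + 5) + T * (21 * m) + (40 * (T * k) + 10 * T + 20))) (input_state R
       d).
Proof.
move=> lek mT; have lek' : (2 * m < 2 ^ k)%N by apply: leq_ltn_trans lek;
  rewrite leq_mul2l mT.
apply: (reach_bind (reach_retract false lek')) =>
  // S1 l1 [q [s0 [l [avq avs avl hE]]]].
apply: (reach_bind (reach_prices false T omega avq avs avl)) => // S2 l2 avp.
apply: reach_weaken (reach_client false C adm avp lek) _ => S3 l3.
move=> [a [b [z [ava avb avz E]]]]; exists a, b, z; split=> // x Dx.
rewrite -E // prices_retract; congr client_profit; apply/rowP => t;
  rewrite !mxE.
by rewrite hE //; apply/l2.2/l3.2.
Qed.

(** Once the client value is written at its minimizer instead of as an infimum, the term is composed
    of clips, polynomials, [C] and projections that are nonexpansive. *)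
Lemma continuous_term : continuous C -> continuous term.
Proof.
move=> cC; have [[_ a0 _] _ _ _] := adm.
have L0 : - Lam <= Lam by have := Lam_ge0; lra.
have chat j : continuous (hat j) by apply: continuous_clip => //;
  apply: coord_continuous.
pose q u := Defs.proj (price_levels plb pub) (\row_n hat_q n u).
pose s0 u := clip 0 T%:R (hat_s u).
pose l u := Defs.proj (lengths L_ omega) (\row_s hat_l s u).
have cq n : continuous (fun u => q u 0 n).
  apply: continuous_proj => [u|i]; first exact: price_levels_variational.
  by under eq_fun do rewrite mxE; apply: chat.
have cs : continuous s0 by apply: continuous_clip (chat _); apply: ler0n.
have cl s : continuous (fun u => l u 0 s).
  apply: continuous_proj => [u|i]; first exact: lengths_variational.
  by under eq_fun do rewrite mxE; apply: chat.
have ca s : continuous (fun u => subperiod_start (s0 u) (l u) s).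
  by apply: continuous_add cs _; apply: continuous_sum => r _; apply: cl.
pose p (t : 'I_T) u := price_formula omega (q u) (s0 u) (l u) t.
have ccst (a : R) : continuous (fun _ : 'rV[R]_d => a) by move=> u;
  apply: cst_continuous.
have cp t : continuous (p t).
  apply: continuous_sum => s _; apply: continuous_mul; first exact: cq.
  have ct : t%:R <= t%:R + 1 :> R by rewrite lerDl.
  have cb : continuous (fun u => subperiod_start (s0 u) (l u) s + l u 0 s).
    by apply: continuous_add; [apply: ca|apply: cl].
  apply: continuous_add; apply: continuous_sub; apply: continuous_clip => //.
  - exact: continuous_sub.
  - exact: continuous_sub.
pose x u := client_load c (\row_t p t u).
have cx t : continuous (fun u => x u 0 t).
  apply: continuous_proj => [u|i]; first exact: loads_variational.
  under eq_fun do rewrite !mxE.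
  by apply: continuous_sub => //; apply: continuous_mul.
pose V u := \sum_t p t u * x u 0 t + (2 * cl_alpha c)^-1 * \sum_t (x u 0 t -
  cl_x0 c 0 t) ^+ 2.
have cbill : continuous (fun u => \sum_t p t u * x u 0 t).
  by apply: continuous_sum => t _; apply: continuous_mul.
have cV : continuous V.
  apply: continuous_add => //; apply: continuous_mul => //.
  apply: continuous_sum => t _; under eq_fun do rewrite expr2.
  by apply: continuous_mul; apply: continuous_sub.
have cCx : continuous (fun u => C (\row_t x u 0 t)).
  move=> u; apply: (@continuous_comp _ _ _ (fun u => \row_t x u 0 t) C);
    last exact: cC.
  exact: continuous_row.
pose y u := clip 0 1 (cl_beta c * (client_value c (cl_p0 c) - V u)).
have cy : continuous y.
  by apply: continuous_clip ler01 _; apply: continuous_mul => //;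
    apply: continuous_sub.
rewrite (_ : term = fun u => cl_w c * (\sum_t p t u * x u 0 t - C (\row_t x u 0
  t)) * y u).
  apply: continuous_mul => //; apply: continuous_mul => //.
  exact: continuous_sub.
apply/funext => u; rewrite prices_retract retractE /= -/(q u) -/(s0 u) -/(l u).
rewrite -/(p _ u); have [z vz] := loads_variational (cl_x0 c - cl_alpha c *:
  \row_t p t u) adm.
have xE : x u = z by rewrite /x /client_load (proj_variational vz).
rewrite /client_profit /client_uptake projR_itv ?ler01 // -/(x u).
rewrite (client_value_variational a0 vz) -xE;
  congr (_ * (_ - C _) * clip _ _ (_ * (_ - _))).
- by apply: eq_bigr => t _; rewrite mxE.
- by apply/rowP => t; rewrite mxE.
- by congr (_ + _); apply: eq_bigr => t _; rewrite mxE.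
Qed.

End Problem.

(** * Operation count and conclusion *)

Lemma cost_bound (T N m Sb k : nat) :
  (1 <= N)%N -> (N <= Sb)%N -> (1 <= m)%N -> (m <= Sb)%N -> (Sb <= T)%N ->
  (k <= T + 2)%N ->
  (4 * (N + 1 + m) + (8 * (N * N) + 4 * N) + 4 + N * (40 * (m * k)) +
     (m * (m + 5) + T * (21 * m) + (40 * (T * k) + 10 * T + 20))
   <= 300 * (T * Sb ^ 2) + 40 * (T * k))%N.
Proof.
move=> N1 NS m1 mS ST kT.
have S1 : (1 <= Sb)%N by apply: leq_trans NS.
have SS : (Sb <= Sb ^ 2)%N by rewrite expnS expn1 leq_pmulr.
have SSS : (Sb ^ 2 <= T * Sb ^ 2)%N by rewrite leq_pmull // (leq_trans S1).
have TS : (T * Sb <= T * Sb ^ 2)%N by rewrite leq_mul2l SS orbT.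
have TT : (T <= T * Sb ^ 2)%N by rewrite leq_pmulr // expn_gt0 S1.
have NN : (N * N <= Sb ^ 2)%N by rewrite expnS expn1 leq_mul.
have mm : (m * m <= Sb ^ 2)%N by rewrite expnS expn1 leq_mul.
have Nm : (N * m <= Sb ^ 2)%N by rewrite expnS expn1 leq_mul.
have Tm : (T * m <= T * Sb)%N by rewrite leq_mul2l mS orbT.
(* The logarithmic factor of the length projection is absorbed: [N * m] is at most [Sb ^ 2] and [k]
   at most [3 * T]. Only the load projection keeps its factor [k]. *)
have k3 : (k <= 3 * T)%N by lia.
have Nmk : (N * m * k <= 3 * (T * Sb ^ 2))%N.
  by apply: leq_trans (leq_mul Nm k3) _; rewrite mulnC mulnA.
have -> : (N * (40 * (m * k)) = 40 * (N * m * k))%N by ring.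
have -> : (T * (21 * m) = 21 * (T * m))%N by ring.
have -> : (m * (m + 5) = m * m + 5 * m)%N by ring.
lia.
Qed.

Lemma trunc_log_ln (R : realType) T : (1 <= T)%N ->
  (trunc_log 2 T)%:R <= ln T%:R / ln 2 :> R.
Proof.
move=> T1; rewrite ler_pdivlMr ?ln_gt0 ?ltr1n //.
rewrite mulr_natl -lnXn // ler_ln ?posrE ?exprn_gt0 ?ltr0n //.
by rewrite -natrX ler_nat trunc_logP.
Qed.

Theorem corollary4p9 (R : realType) (c0 : R) :
  exists c : R,
  forall (T N K : nat) (plb pub : R) (S_ L_ : 'I_N -> nat)
    (m : nat) (omega : 'I_m -> 'I_N) (Lam : R) (k : 'I_K -> client R T)
    (C : 'rV[R]_T -> R) (dC : 'rV[R]_T -> 'rV[R]_T) (PC : program R),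
  (1 <= T)%N -> (1 <= N)%N -> (1 <= K)%N ->
  0 <= plb -> plb < pub ->
  (forall n, (1 <= S_ n <= L_ n)%N) ->
  (\sum_n L_ n)%N = T ->
  admissible_order S_ omega ->
  (forall z, feasible T plb pub L_ omega z -> box Lam (pack z)) ->
  (forall i, admissible_client (k i)) ->
  elementary_selection C dC ->
  computes PC C dC ->
  (cost PC)%:R <= c0 * T%:R ->
  let Sbar := (\sum_n S_ n)%N in
  let h := retract T plb pub L_ omega Lam in
  let term i u := client_profit C (k i) (prices T omega (h u)) in
  let Ft u := profit C k (prices T omega (h u)) in
  equivalent_unconstrained Ft (feasible T plb pub L_ omega)
    (fun z => profit C k (prices T omega z)) h
  /\ exists D : 'I_K -> 'rV[R]_(N + 1 + m) -> 'rV[R]_(N + 1 + m),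
       elementary_selection Ft (fun u => \sum_i D i u) /\
       forall i : 'I_K,
         elementary_selection (term i) (D i) /\
         exists P : program R,
           computes P (term i) (D i) /\
           (cost P)%:R <= c * (T%:R * ((Sbar ^ 2)%:R + ln T%:R)).
Proof.
(* Five times the 300 of [cost_bound] and the lower order terms fit in 2000. The last summand is
   five times 40, converted from binary to natural logarithms, and the absolute value of [c0] pays
   for evaluating the cost. *)
exists (2000 + `|c0| + 200 / ln 2).
move=> T N K plb pub S_ L_ m omega Lam k C dC PC T1 N1 _ _ /ltW lePub SL sumL.
move=> [mS _ _] boxL adm selC compC costC Sbar h term Ft.
have blocksL n : (1 <= #|[set s | omega s == n]%SET| <= L_ n)%N.
  have /andP[-> le] := mS n; have /andP[_] := SL n.
  exact: leq_trans.
split; first exact: (equivalent_retract lePub blocksL boxL (fun z =>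
  profit C k (prices T omega z))).
have NS : (N <= Sbar)%N.
  rewrite -[N]card_ord -sum1_card; apply: leq_sum => n _.
  by have /andP[] := SL n.
have ST : (Sbar <= T)%N.
  by rewrite -sumL; apply: leq_sum => n _; have /andP[] := SL n.
have mSb : (m <= Sbar)%N.
  rewrite -[m]card_ord -sum1_card (partition_big omega xpredT) //=.
  apply: leq_sum => n _; have /andP[_] := mS n; apply: leq_trans.
  by rewrite sum1_card cardsE.
have m1 : (1 <= m)%N.
  have /andP[lt _] := mS (Ordinal N1); apply: leq_trans lt _.
  by apply: leq_trans (max_card _) _; rewrite card_ord.
(* One unit above the truncated logarithm makes the power of 2 exceed [T]; the other accounts for
   the factor 2. *)
set j := (trunc_log 2 T).+2.
have lej : (2 * T < 2 ^ j)%N.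
  by rewrite /j expnS ltn_pmul2l // trunc_log_ltn.
have jT : (j <= T + 2)%N.
  by rewrite /j addn2 !ltnS -ltnS -(ltn_exp2l _ _ (m := 2)) // (leq_ltn_trans
    (trunc_logP _ T1)) // ltnW // ltn_expl.
have ex i : exists Df, elementary_selection (term i) Df /\
    exists P : program R, computes P (term i) Df /\
      (cost P <= 5 * (300 * (T * Sbar ^ 2) + 40 * (T * j)) + 2 * T + cost PC +
        6)%N.
  apply: (reach_elementary_selection selC compC).
    by apply: continuous_term => //; case: selC.
  apply: reach_leq (reach_term lePub sumL blocksL boxL C (adm i) lej _).
    exact: cost_bound.
  exact: leq_trans ST.
have [D HD] := choice ex; exists D; split.
  by apply: elementary_selection_sum => i; case: (HD i).
move=> i; have [sel [P [cP leP]]] := HD i; split=> //; exists P; split=> //.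
have T1R : 1 <= T%:R :> R by rewrite (ler_nat _ 1).
have S1R : 1 <= (Sbar ^ 2)%:R :> R.
  by rewrite (ler_nat _ 1) expn_gt0 (leq_trans N1 NS).
have l0 : 0 <= ln T%:R :> R by rewrite ln_ge0.
have l2 : 0 < ln 2 :> R by rewrite ln_gt0 ?ltr1n.
have jR : j%:R <= ln T%:R / ln 2 + 2 :> R.
  by rewrite /j -addn2 natrD lerD2r trunc_log_ln.
have {leP} : (cost P)%:R <= 5 * (300 * (T%:R * (Sbar ^ 2)%:R) + 40 * (T%:R *
  j%:R)) +
    2 * T%:R + (cost PC)%:R + 6 :> R.
  by move: leP; rewrite -(ler_nat R) !(natrD, natrM).
move/le_trans; apply.
set Q := (Sbar ^ 2)%:R in S1R *; set t := T%:R in T1R l0 jR costC *;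
  set L := ln t in l0 jR *.
have t0 : 0 <= t by lra.
have h1 : t * j%:R <= t * (L / ln 2) + 2 * t.
  by have := ler_wpM2l t0 jR; rewrite mulrDr; lra.
have h2 : t <= t * Q by rewrite ler_peMr.
have h3 : c0 * t <= `|c0| * (t * (Q + L)).
  apply: (@le_trans _ _ (`|c0| * t)); first by rewrite ler_wpM2r // ler_norm.
  by rewrite ler_wpM2l // ler_peMr //; lra.
have h4 : t * (L / ln 2) <= (ln 2)^-1 * (t * (Q + L)).
  rewrite mulrA [leLHS]mulrC; rewrite ler_wpM2l ?invr_ge0 ?(ltW l2) //.
  by rewrite ler_wpM2l //; lra.
have h5 : 0 <= t * L by apply: mulr_ge0.
rewrite [leRHS](_ : _ = 2000 * (t * Q) + 2000 * (t * L) + `|c0| * (t * (Q + L))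
  +
  200 * ((ln 2)^-1 * (t * (Q + L)))); last by ring.
lra.
Qed.
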